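(* If the Riemannian manifold $(E,\mathrm{g}_{M,E})$ is Einstein, with $\mathrm{ric}^{\mathrm{g}_{M,E}}=\lambda^E\,\mathrm{g}_{M,E}$, then $M$ is Einstein, say with Einstein constant $\lambda^M$ ($\mathrm{ric}^M=\lambda^Mg_M$), and at the zero section $$\lambda^M e^{2\varphi_2-2\varphi_1}+a(m-k)+2b(k-1)=0 .$$ Moreover $$\lambda^E=\bigl(2b(1-k)-am\bigr)e^{-2\varphi_2}=\lambda^Me^{-2\varphi_1}-ak\,e^{-2\varphi_2}.$$ Here $a=2\varphi_1'(0)$, $b=2\varphi_2'(0)$ and $\varphi_1,\varphi_2$ are evaluated at $r=0$.
   Context: $(M,g_M)$ is a Riemannian manifold of dimension $m$; $\pi:E\to M$ is a real vector bundle of rank $k$ with a fibre metric $g_E$ and a compatible connection $D^E$ ($D^Eg_E=0$). The vertical bundle $\ker d\pi\subset TE$ is identified with the pull-back $\pi^\star E$; the connection $D^E$ determines a horizontal complement, identified through $d\pi$ with the pull-back $\pi^*TM$, so $TE\simeq\pi^*TM\oplus\pi^\star E$. (Both $\pi^*$ and $\pi^\star$ denote ordinary pull-back by $\pi$.) Let $r(e)=\|e\|_E^2$ and let $\varphi_1,\varphi_2$ be functions of $r$ only, smooth for $r\ge0$ (smooth on the right at $r=0$); the prime is the derivative in $r$. The metric on the manifold $E$ is $$\mathrm{g}_{M,E}=e^{2\varphi_1}\pi^*g_M\oplus e^{2\varphi_2}\pi^\star g_E .$$ The Ricci tensor is $\mathrm{ric}(X,Y)=\mathrm{tr}\,R(\cdot,X)Y$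 with $R(X,Y)Z=\nabla_X\nabla_YZ-\nabla_Y\nabla_XZ-\nabla_{[X,Y]}Z$. *)

(* Defs.v *)
From HB Require Import structures.
From mathcomp Require Import all_boot all_order all_algebra.
From mathcomp Require Import all_classical all_reals all_analysis.

Set Implicit Arguments.
Unset Strict Implicit.
Unset Printing Implicit Defensive.

Import Order.TTheory GRing.Theory Num.Theory.
Import numFieldNormedType.Exports.

Local Open Scope classical_set_scope.
Local Open Scope ring_scope.

(* Conventions: tangent vectors and fibre coordinates are row vectors, a
   bilinear form with Gram matrix G is (u, v) |-> u G v^T, and the Jacobian 'J
   acts on the right. *)

Section Euclidean.
Variables (R : realType) (n : nat).

Definition basis_vec (a : 'I_n) : 'rV[R]_n := delta_mx 0 a.

Definition partial (V : normedModType R) (f : 'rV[R]_n -> V) (a : 'I_n) :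
    'rV[R]_n -> V :=
  fun x => 'D_(basis_vec a) f x.

(* C^oo on an open set U: all iterated partial derivatives exist and are
   continuous at the points of U. *)
Definition smooth_on (V : normedModType R) (U : set 'rV[R]_n)
    (f : 'rV[R]_n -> V) : Prop :=
  forall (s : seq 'I_n) (x : 'rV[R]_n), U x ->
    {for x, continuous (foldl (@partial V) f s)} /\
    (forall a, derivable (foldl (@partial V) f s) x (basis_vec a)).

Definition bilin (G : 'M[R]_n) (u v : 'rV[R]_n) : R := (u *m G *m v^T) 0 0.

Definition positive_definite (G : 'M[R]_n) : Prop :=
  G^T = G /\ (forall u : 'rV[R]_n, u != 0 -> 0 < bilin G u u).

End Euclidean.

(* Derivative of a function on the half-line [0, +oo[: two-sided for r > 0,
   from the right at r = 0; values at negative arguments play no role. *)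
Section HalfLine.
Variable R : realType.

Definition halfline_quotient (f : R -> R) (r : R) : set_system R :=
  (h^-1 * (f (r + h) - f r)) @[h --> within [set h : R | 0 <= r + h] 0^'].

Definition halfline_derive (f : R -> R) (r : R) : R :=
  lim (halfline_quotient f r).

Definition smooth_halfline (f : R -> R) : Prop :=
  forall (p : nat) (r : R), 0 <= r ->
    cvg (halfline_quotient (iter p halfline_derive f) r).

End HalfLine.

(* Riemannian geometry in a coordinate domain of R^n with Gram matrix G;
   vector fields are maps 'rV_n -> 'rV_n. *)
Section LocalRiemannian.
Variables (R : realType) (n : nat) (G : 'rV[R]_n -> 'M[R]_n).
Local Notation field := ('rV[R]_n -> 'rV[R]_n).

(* Gamma^c_{ab} of the Levi-Civita connection *)
Definition christoffel (x : 'rV[R]_n) (a b c : 'I_n) : R :=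
  2^-1 * \sum_(d < n) invmx (G x) c d *
    (partial (fun y => G y b d) a x + partial (fun y => G y a d) b x
     - partial (fun y => G y a b) d x).

Definition levi_civita (X Y : field) : field := fun x =>
  'D_(X x) Y x +
  \row_c \sum_(a < n) \sum_(b < n) christoffel x a b c * X x 0 a * Y x 0 b.

Definition lie_bracket (X Y : field) : field := fun x =>
  'D_(X x) Y x - 'D_(Y x) X x.

Definition curvature (X Y Z : field) : field := fun x =>
  levi_civita X (levi_civita Y Z) x - levi_civita Y (levi_civita X Z) x
  - levi_civita (lie_bracket X Y) Z x.

(* trace of the endomorphism R(., X) Y *)
Definition ricci (X Y : field) : 'rV[R]_n -> R := fun x =>
  \sum_(a < n) curvature (cst (basis_vec R a)) X Y x 0 a.

(* The Ricci tensor is evaluated on tangent vectors u, v at x through their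
   extensions with constant coordinates. *)
Definition einstein_on (U : set 'rV[R]_n) (lambda : R) : Prop :=
  forall x, U x -> forall u v : 'rV[R]_n,
    ricci (cst u) (cst v) x = lambda * bilin (G x) u v.

End LocalRiemannian.

Section Manifolds.
Variable R : realType.

(* [coord i] is the chart on [dom i] and [point i] its inverse; both are
   irrelevant outside [dom i], resp. outside the image [img A i]. *)
Record atlas (n : nat) (M : topologicalType) := Atlas {
  idx : Type;
  dom : idx -> set M;
  coord : idx -> M -> 'rV[R]_n;
  point : idx -> 'rV[R]_n -> M }.

Section Manifold.
Variables (n : nat) (M : topologicalType) (A : atlas n M).

Definition img (i : idx A) : set 'rV[R]_n := coord i @` dom i.

Definition transition (i j : idx A) : 'rV[R]_n -> 'rV[R]_n :=
  coord j \o point i.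

Definition smooth_atlas : Prop :=
  [/\ forall p : M, exists i : idx A, dom i p,
      forall i : idx A, open (dom i) /\ open (img i),
      forall (i : idx A) p, dom i p -> point i (coord i p) = p,
      forall i : idx A,
        (forall p, dom i p -> {for p, continuous (coord i)}) /\
        (forall x, img i x -> {for x, continuous (@point _ _ A i)}) &
      forall i j : idx A,
        smooth_on (coord i @` (dom i `&` dom j)) (transition i j)].

Definition smooth_manifold : Prop :=
  [/\ hausdorff_space M, @second_countable M, [set: M] !=set0 & smooth_atlas].

(* A symmetric 2-tensor is given by its Gram matrices in the charts. *)
Definition riemannian_metric (g : idx A -> 'rV[R]_n -> 'M[R]_n) : Prop :=
  [/\ forall i, smooth_on (img i) (g i),
      forall i x, img i x -> positive_definite (g i x) &
      forall i j p, (dom i `&` dom j) p ->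
        let J := 'J (transition i j) (coord i p) in
        g i (coord i p) = J *m g j (coord j p) *m J^T].

Definition einstein (g : idx A -> 'rV[R]_n -> 'M[R]_n) (lambda : R) : Prop :=
  forall i, einstein_on (g i) (img i) lambda.

End Manifold.

(* Local trivialisations of pi : E -> M of rank k: over [tdom t] the fibre
   coordinate is [fib t], and [lift t p v] is the point of the fibre over p
   with fibre coordinate v. *)
Record trivialisations (k : nat) (M E : topologicalType) := Trivialisations {
  tidx : Type;
  tdom : tidx -> set M;
  fib : tidx -> E -> 'rV[R]_k;
  lift : tidx -> M -> 'rV[R]_k -> E }.

Section Bundle.
Variables (m k : nat) (M E : topologicalType) (pi : E -> M).
Variables (A : atlas m M) (B : trivialisations k M E).

(* matrix of the change of fibre coordinates from t to u over p *)
Definition cocycle (t u : tidx B) (p : M) : 'M[R]_k :=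
  lin1_mx (fun v => fib u (lift t p v)).

Definition vector_bundle : Prop :=
  continuous pi /\
  [/\ forall p : M, exists t : tidx B, tdom t p,
      forall t : tidx B, open (tdom t),
      forall t : tidx B,
        (forall e, tdom t (pi e) -> lift t (pi e) (fib t e) = e) /\
        (forall p v, tdom t p ->
           pi (lift t p v) = p /\ fib t (lift t p v) = v),
      forall t : tidx B,
        (forall e, tdom t (pi e) -> {for e, continuous (fib t)}) /\
        (forall p v, tdom t p ->
           {for (p, v), continuous (fun q : M * 'rV[R]_k =>
              @lift _ _ _ B t q.1 q.2)}) &
      forall t u : tidx B,
        (forall p v, (tdom t `&` tdom u) p ->
           fib u (lift t p v) = v *m cocycle t u p) /\
        (forall i : idx A,
           smooth_on (coord i @` (dom i `&` (tdom t `&` tdom u)))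
             (cocycle t u \o point i))].

(* domain in R^m shared by the chart i and the trivialisation t *)
Definition bimg (i : idx A) (t : tidx B) : set 'rV[R]_m :=
  coord i @` (dom i `&` tdom t).

Definition fibre_metric (h : tidx B -> M -> 'M[R]_k) : Prop :=
  [/\ forall i t, smooth_on (bimg i t) (h t \o point i),
      forall t p, tdom t p -> positive_definite (h t p) &
      forall t u p, (tdom t `&` tdom u) p ->
        h t p = cocycle t u p *m h u p *m (cocycle t u p)^T].

(* [w i t x a] is the connection matrix along the a-th coordinate vector. *)
Variable w : idx A -> tidx B -> 'rV[R]_m -> 'I_m -> 'M[R]_k.

Definition connection_form i t (x xi : 'rV[R]_m) : 'M[R]_k :=
  \sum_(a < m) xi 0 a *: w i t x a.

(* D_xi s at x, a local section being a map 'rV_m -> 'rV_k *)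
Definition covariant_derivative i t (xi : 'rV[R]_m)
    (s : 'rV[R]_m -> 'rV[R]_k) (x : 'rV[R]_m) : 'rV[R]_k :=
  'D_xi s x + s x *m connection_form i t x xi.

(* In the second clause s is a section in the coordinates (j, u) and s' the
   same section in the coordinates (i, t). *)
Definition linear_connection : Prop :=
  (forall i t a, smooth_on (bimg i t) (fun x => w i t x a)) /\
  (forall i t j u,
     let W := (dom i `&` tdom t) `&` (dom j `&` tdom u) in
     forall s : 'rV[R]_m -> 'rV[R]_k, smooth_on (coord j @` W) s ->
     let s' := fun x => s (transition i j x) *m cocycle u t (point i x) in
     forall p xi, W p ->
       covariant_derivative i t xi s' (coord i p) =
       covariant_derivative j u (xi *m 'J (transition i j) (coord i p)) s
         (coord j p) *m cocycle u t p).

Variable h : tidx B -> M -> 'M[R]_k.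

(* D g_E = 0, i.e. xi (g_E(s, s')) = g_E(D_xi s, s') + g_E(s, D_xi s') *)
Definition compatible_connection : Prop :=
  forall i t (s s' : 'rV[R]_m -> 'rV[R]_k),
    smooth_on (bimg i t) s -> smooth_on (bimg i t) s' ->
    forall x xi, bimg i t x ->
      'D_xi (fun y => bilin (h t (point i y)) (s y) (s' y)) x =
      bilin (h t (point i x)) (covariant_derivative i t xi s x) (s' x) +
      bilin (h t (point i x)) (s x) (covariant_derivative i t xi s' x).

Definition total_space_atlas : atlas (m + k) E :=
  {| idx := (idx A * tidx B)%type;
     dom := fun it => pi @^-1` (dom it.1 `&` tdom it.2);
     coord := fun it e => row_mx (coord it.1 (pi e)) (fib it.2 e);
     point := fun it z => lift it.2 (point it.1 (lsubmx z)) (rsubmx z) |}.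

(* Vertical component, in the fibre coordinates, of the tangent vector zeta at
   the point z of E: the projection onto ker(d pi) along the horizontal space.
   The latter consists of the velocities of parallel sections along curves,
   i.e. of the pairs (xi, eta) with eta + v w(xi) = 0 at z = (x, v). *)
Definition vertical_part i t (z zeta : 'rV[R]_(m + k)) : 'rV[R]_k :=
  rsubmx zeta + rsubmx z *m connection_form i t (lsubmx z) (lsubmx zeta).

Variable g : idx A -> 'rV[R]_m -> 'M[R]_m.
Variables phi1 phi2 : R -> R.

(* e^(2 phi1(r)) pi^* g_M + e^(2 phi2(r)) pi^* g_E with r = ||e||^2 *)
Definition total_space_metric (it : idx A * tidx B)
    (z : 'rV[R]_(m + k)) : 'M[R]_(m + k) :=
  let: (i, t) := it in
  let x := lsubmx z in
  let gE := h t (point i x) in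
  let r := bilin gE (rsubmx z) (rsubmx z) in
  \matrix_(a, b)
    (expR (2 * phi1 r) *
       bilin (g i x) (lsubmx (basis_vec R a)) (lsubmx (basis_vec R b)) +
     expR (2 * phi2 r) *
       bilin gE (vertical_part i t z (basis_vec R a))
                (vertical_part i t z (basis_vec R b))).

End Bundle.
End Manifolds.

Arguments riemannian_metric {R n M} A g.
Arguments einstein {R n M} A g lambda.
Arguments fibre_metric {R m k M E} A B h.
Arguments linear_connection {R m k M E} A B w.
Arguments compatible_connection {R m k M E} A B w h.
Arguments total_space_atlas {R m k M E} pi A B.
Arguments total_space_metric {R m k M E A B} w h g phi1 phi2.

(* Main.v *)
(** At the zero section every fibrewise gradient of ||e||^2 vanishes, so only
    first derivatives of phi1 and phi2 survive in the Ricci tensor there.  In a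
    chart of M and a trivialisation of E with connection matrices w_i, the metric
    on E has Gram matrix P D P^T with P = (1, W; 0, 1), W_i = v w_i and
    D = diag(e^(2 phi1) g, e^(2 phi2) h); hence its inverse is explicit, and the
    vertical derivatives at v = 0 of the Christoffel symbols are too.  At v = 0
    the only nonzero Christoffel symbols are those of M and the mixed ones
    Gamma^c_(i b) = (w_i)_(b c), by compatibility of the connection.  One finds
      ric(d_i, d_j) = ric^M_ij - a k e^(2 phi1 - 2 phi2) g_ij,
      ric(d_c, d_c) = (2 b (1 - k) - a m) h_cc,
    the terms in w cancelling because the curvature of a metric connection is
    traceless; the latter is the symmetry of the second derivatives of h, traced
    against its inverse.  Comparing with lambdaE times the metric gives
    everything, lambdaM being e^(2 phi1) (lambdaE + a k e^(- 2 phi2)). *)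
Require Import Defs.
From HB Require Import structures.
From mathcomp Require Import all_boot all_order all_algebra.
From mathcomp Require Import all_classical all_reals all_analysis.
From mathcomp Require Import ring lra.
Import Order.TTheory GRing.Theory Num.Theory.
Import numFieldNormedType.Exports.
Local Open Scope classical_set_scope.
Local Open Scope ring_scope.
Set Implicit Arguments.
Unset Strict Implicit.
Unset Printing Implicit Defensive.

(** * Directional derivatives *)

(** The metric on E is never shown to be smooth. On the zero section r = 0, where phi1 and phi2 have
    only one-sided derivatives, so differentiation there rests on a chain rule relative to the
    half-line, r being nonnegative nearby. The first derivatives of the metric are found at every
    point over U, as they must be differentiated again; second ones only in vertical directions at v
    = 0. Accordingly the partial derivatives of the Christoffel symbols of E are found only at the
    zero section, in two ways: the horizontal ones from the closed values of the symbols along it,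
    the vertical ones from their explicit formula nearby. For the Ricci tensor of E the horizontal
    block and the vertical diagonal are enough: one diagonal entry fixes lambdaE, because h_cc > 0.
    The coefficients that appear depend only on m, k, lambdaE and the values phi(0), phi'(0), hence
    lambdaM is the same number in all charts and constancy over M needs no separate argument. *)

Section DirectionalDerivatives.
Context {R : realType} {V : normedModType R}.
Implicit Types (f g : V -> R) (x y v : V).

(* pointwise forms of the library rules, whose conclusions on f + g, f * g, ...
   do not unify with explicit lambda abstractions *)
Lemma is_derive_peq f x v df df' :
  is_derive x v f df -> df = df' -> is_derive x v f df'.
Proof. by move=> ? <-. Qed.

Lemma is_derive_pD f g x v df dg : is_derive x v f df -> is_derive x v g dg ->
  is_derive x v (fun y => f y + g y) (df + dg).
Proof. by move=> ? ?; exact: is_deriveD. Qed.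

Lemma is_derive_pN f x v df : is_derive x v f df ->
  is_derive x v (fun y => - f y) (- df).
Proof. by move=> ?; exact: is_deriveN. Qed.

Lemma is_derive_pM f g x v df dg : is_derive x v f df -> is_derive x v g dg ->
  is_derive x v (fun y => f y * g y) (df * g x + f x * dg).
Proof.
move=> fP gP; have fgP := is_deriveM fP gP.
suff -> : df * g x + f x * dg = f x *: dg + g x *: df by exact: fgP.
by rewrite addrC /GRing.scale /= [g x * _]mulrC.
Qed.

Lemma is_derive_psum (I : finType) (f : I -> V -> R) x v (df : I -> R) :
  (forall i, is_derive x v (f i) (df i)) ->
  is_derive x v (fun y => \sum_i f i y) (\sum_i df i).
Proof.
move=> fP; rewrite -fct_sumE; elim/big_ind2: _ => //.
  exact: is_derive_cst.
by move=> *; exact: is_derive_pD.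
Qed.

Lemma is_derive_pcst (c : R) x v : is_derive x v (fun=> c) 0.
Proof. exact: is_derive_cst. Qed.

Lemma is_derive_pMr f (c : R) x v df : is_derive x v f df ->
  is_derive x v (fun y => f y * c) (df * c).
Proof.
by move=> fd; have := is_derive_pM fd (is_derive_pcst c x v); rewrite mulr0 addr0.
Qed.

Lemma is_derive_line f y v (s : R) : derivable f (y + s *: v) v ->
  is_derive s 1 (fun t => f (y + t *: v)) ('D_v f (y + s *: v)).
Proof.
have E : (fun h : R => h^-1 *: (((fun t => f (y + t *: v)) \o shift s) (h *: 1)
            - f (y + s *: v))) =
         (fun h : R => h^-1 *: ((f \o shift (y + s *: v)) (h *: v)
            - f (y + s *: v))).
  apply/funext => h /=; congr (_ *: (f _ - _)).
  by rewrite [h *: 1]mulr1 scalerDl addrCA.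
move=> fP; apply: DeriveDef; first by rewrite /derivable E.
by rewrite /derive E.
Qed.

(** The bounds are weak and t may have either sign or vanish, since t will be an arbitrary
    coordinate of a vector. For t < 0 the mean value theorem is applied on [t, 0]. *)
Lemma MVT_line f y v (t : R) :
  (forall s : R, `|s| <= `|t| -> derivable f (y + s *: v) v) ->
  exists2 s, `|s| <= `|t| &
    f (y + t *: v) - f y = t * 'D_v f (y + s *: v).
Proof.
move=> fP; set phi := fun t => f (y + t *: v).
have phi0 : phi 0 = f y by rewrite /phi scale0r addr0.
have dphi (s : R) : `|s| <= `|t| -> is_derive s 1 phi ('D_v f (y + s *: v)).
  by move=> /fP; exact: is_derive_line.
have [t0|t0] := leP 0 t.
- have P (s : R) : s \in `[0, t] -> `|s| <= `|t|.
    by rewrite in_itv /= => /andP[s0 st]; rewrite !ger0_norm.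
  have [||c cP] := @MVT_segment _ phi (fun s => 'D_v f (y + s *: v)) _ _ t0.
  + by move=> s sP; apply/dphi/P/subset_itv_oo_cc.
  + by apply: derivable_within_continuous => s /P/dphi[].
  rewrite phi0 subr0 mulrC => E; exists c => //; exact: P.
- have P (s : R) : s \in `[t, 0] -> `|s| <= `|t|.
    rewrite in_itv /= => /andP[st s0].
    by rewrite !ler0_norm ?lerN2 // ltW.
  have [||c cP] := @MVT_segment _ phi (fun s => 'D_v f (y + s *: v)) _ _ (ltW t0).
  + by move=> s sP; apply/dphi/P/subset_itv_oo_cc.
  + by apply: derivable_within_continuous => s /P/dphi[].
  rewrite phi0 sub0r mulrN => E; exists c; first exact: P.
  by rewrite [t * _]mulrC -[RHS]opprK -E opprB.
Qed.

End DirectionalDerivatives.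

(** * Symmetry of second derivatives *)

Section Schwarz.
Context {R : realType} {V : normedModType R}.

(** The mean value theorem twice: for y |-> f (y + t b) - f y along a, then for the derivative of f
    in direction a, along b. *)
Lemma second_difference (f : V -> R) x a b (t : R) :
  (forall s s' : R, `|s| <= `|t| -> `|s'| <= `|t| ->
     derivable f (x + s *: a + s' *: b) a /\
     derivable (fun y => 'D_a f y) (x + s *: a + s' *: b) b) ->
  exists s s', [/\ `|s| <= `|t|, `|s'| <= `|t| &
    f (x + t *: a + t *: b) - f (x + t *: a) - (f (x + t *: b) - f x) =
    t * (t * 'D_b (fun y => 'D_a f y) (x + s *: a + s' *: b))].
Proof.
move=> fP.
pose g y := f (y + t *: b) - f y.
have dshift y : derivable f (y + t *: b) a ->
    is_derive y a (fun y => f (y + t *: b)) ('D_a f (y + t *: b)).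
  have E : (fun h : R => h^-1 *: (((fun y => f (y + t *: b)) \o shift y) (h *: a)
              - f (y + t *: b))) =
           (fun h : R => h^-1 *: ((f \o shift (y + t *: b)) (h *: a)
              - f (y + t *: b))).
    by apply/funext => h /=; rewrite addrA.
  move=> fP'; apply: DeriveDef; first by rewrite /derivable E.
  by rewrite /derive E.
have dg (s : R) : `|s| <= `|t| -> is_derive (x + s *: a) a g
    ('D_a f (x + s *: a + t *: b) - 'D_a f (x + s *: a)).
  move=> sP; apply: is_derive_pD.
    by apply: dshift; have [] := fP s t sP (lexx _).
  apply: is_derive_pN; have [] := fP s 0 sP; first by rewrite normr0.
  by rewrite scale0r addr0 => ? _; exact: derivableP.
have [s sP E] := @MVT_line _ _ g x a t
  (fun s sP => @ex_derive _ _ _ _ _ _ _ (dg s sP)).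
rewrite (@derive_val _ _ _ _ _ _ _ (dg s sP)) in E.
have [s' sP' E'] := @MVT_line _ _ (fun y => 'D_a f y) (x + s *: a) b t
   (fun s' sP' => (fP s s' sP sP').2).
by exists s, s'; split => //; rewrite -E' -E.
Qed.

(** The second difference is symmetric in a and b, so both mixed derivatives take a common value at
    two points near x; continuity at x then makes them differ by less than any e. *)
Lemma schwarz (f : V -> R) x a b :
  (\forall y \near x, derivable f y a) -> (\forall y \near x, derivable f y b) ->
  (\forall y \near x, derivable (fun y => 'D_a f y) y b) ->
  (\forall y \near x, derivable (fun y => 'D_b f y) y a) ->
  {for x, continuous (fun y => 'D_b (fun y => 'D_a f y) y)} ->
  {for x, continuous (fun y => 'D_a (fun y => 'D_b f y) y)} ->
  'D_b (fun y => 'D_a f y) x = 'D_a (fun y => 'D_b f y) x.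
Proof.
move=> fa fb fab fba cab cba.
apply/eqP; rewrite -subr_eq0 -normr_le0; apply/ler_addgt0Pl => e e0.
rewrite addr0.
have e20 : 0 < e / 2 by rewrite divr_gt0.
move/cvgrPdist_lt: cab => /(_ _ e20) cab.
move/cvgrPdist_lt: cba => /(_ _ e20) cba.
have [d /= d0 dP'] := (nbhs_normP _ _).1
  (filterI (filterI (filterI fa fb) (filterI fab fba)) (filterI cab cba)).
have dP y : `|x - y| < d ->
   [/\ derivable f y a, derivable f y b, derivable (fun y => 'D_a f y) y b,
       derivable (fun y => 'D_b f y) y a &
       `|'D_b (fun y => 'D_a f y) x - 'D_b (fun y => 'D_a f y) y| < e / 2 /\
       `|'D_a (fun y => 'D_b f y) x - 'D_a (fun y => 'D_b f y) y| < e / 2].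
  by move=> /dP'[[[? ?] [? ?]] ?]; split.
(* The summand 1 keeps the denominator positive when a = b = 0, and makes the parallelogram of sides
   t a, t b lie strictly inside the ball of radius d. *)
pose t := d / (`|a| + `|b| + 1).
have p0 : 0 < `|a| + `|b| + 1 by rewrite ltr_wpDl // addr_ge0.
have t0 : 0 < t by rewrite divr_gt0.
have tP (s s' : R) : `|s| <= `|t| -> `|s'| <= `|t| ->
    `|x - (x + s *: a + s' *: b)| < d.
  rewrite (gtr0_norm t0) => sP sP'.
  rewrite -addrA opprD addrA subrr sub0r normrN.
  apply: le_lt_trans (ler_normD _ _) _; rewrite !normrZ.
  apply: (@le_lt_trans _ _ (t * (`|a| + `|b|))).
    by rewrite mulrDr lerD // ler_wpM2r.
  by rewrite /t mulrAC ltr_pdivrMr // ltr_pM2l // ltrDl.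
have tP' (s s' : R) : `|s| <= `|t| -> `|s'| <= `|t| ->
    `|x - (x + s *: b + s' *: a)| < d.
  by move=> sP sP'; rewrite addrAC; exact: tP.
have [|s1 [s1' [s1P s1P' E1]]] := @second_difference f x a b t.
  move=> s s' sP sP'; have [da _ dab _ _] := dP _ (tP s s' sP sP').
  exact: (conj da dab).
have [|s2 [s2' [s2P s2P' E2]]] := @second_difference f x b a t.
  move=> s s' sP sP'; have [_ db _ dba _] := dP _ (tP' s s' sP sP').
  exact: (conj db dba).
have [_ _ _ _ [C1 _]] := dP _ (tP _ _ s1P s1P').
have [_ _ _ _ [_ C2]] := dP _ (tP' _ _ s2P s2P').
have E : 'D_b (fun y => 'D_a f y) (x + s1 *: a + s1' *: b) =
         'D_a (fun y => 'D_b f y) (x + s2 *: b + s2' *: a).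
  apply: (mulfI (lt0r_neq0 t0)); apply: (mulfI (lt0r_neq0 t0)).
  apply: (etrans (esym E1)); apply: (etrans _ E2).
  rewrite (addrAC x (t *: b)); ring.
rewrite E in C1.
apply: ltW; rewrite [e]splitr; apply: le_lt_trans (ltrD C1 C2).
by rewrite [X in _ <= _ + X]distrC; exact: ler_distD.
Qed.

End Schwarz.
(** * Smooth functions *)

Section Smooth.
Context {R : realType} {n : nat}.
Implicit Types (x y u v : 'rV[R]_n).

Definition linear_form (c : 'I_n -> R) : 'rV[R]_n -> R :=
  fun u => \sum_a u 0 a * c a.

Fact linear_form_is_linear c : linear (linear_form c).
Proof.
move=> k u v; rewrite /linear_form scaler_sumr -big_split /=.
by apply: eq_bigr => a _; rewrite !mxE mulrDl -mulrA.
Qed.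

HB.instance Definition _ c :=
  GRing.isLinear.Build R 'rV[R]_n R *:%R (linear_form c)
    (linear_form_is_linear c).

Lemma linear_form_continuous c : continuous (linear_form c).
Proof.
rewrite /linear_form -fct_sumE; elim/big_ind: _ => [|f g fc gc|a _] u.
- exact: cst_continuous.
- exact: (continuousD (fc u) (gc u)).
- exact: (continuousM (@coord_continuous R _ _ 0 a u) (@cst_continuous _ _ (c a) u)).
Qed.

(** The points [x + truncation j u] are the vertices of a path from x to x + u that moves along one
    coordinate axis at a time. *)
Definition truncation (j : nat) u : 'rV[R]_n :=
  \row_a (if (a < j)%N then u 0 a else 0).

Lemma row_norm_ub u (e : R) : 0 <= e -> (forall a, `|u 0 a| <= e) -> `|u| <= e.
Proof.
move=> e0 uP; rewrite [leLHS]/Num.Def.normr/= mx_normrE (bigmax_le _ e0)//=.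
by move=> -[i j] _ /=; rewrite ord1.
Qed.

Lemma row_norm_lb u a : `|u 0 a| <= `|u|.
Proof.
rewrite [leRHS]/Num.Def.normr/= mx_normrE.
exact: (le_bigmax _ (fun ij : 'I_1 * 'I_n => `|u ij.1 ij.2|) (0, a)).
Qed.

(** Each edge of the path costs at most e * |u|: by the mean value theorem the increment along it is
    u_a times a partial derivative that is within e of c_a. *)
Lemma truncation_increment u (f : 'rV[R]_n -> R) x (c : 'I_n -> R) (e : R) :
  (forall y, `|y - x| <= `|u| -> forall a,
     derivable f y (basis_vec R a) /\ `|partial f a y - c a| <= e) ->
  forall j, (j <= n)%N ->
  `|f (x + truncation j u) - f x - linear_form c (truncation j u)|
    <= j%:R * e * `|u|.
Proof.
move=> fP; elim=> [_|j IH jn].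
  have -> : truncation 0 u = 0 by apply/rowP => a; rewrite !mxE.
  by rewrite addr0 subrr linear0 subr0 normr0 !mul0r.
pose a := Ordinal jn.
have tS : truncation j.+1 u = truncation j u + u 0 a *: basis_vec R a.
  apply/rowP => b; rewrite !mxE /= ltnS leq_eqVlt.
  have [->|ba] := eqVneq b a.
    by rewrite eqxx ltnn add0r mulr1.
  have -> : (b == j :> nat) = false by apply/negbTE.
  by rewrite mulr0 addr0.
have near_s (s : R) : `|s| <= `|u 0 a| ->
    `|x + truncation j u + s *: basis_vec R a - x| <= `|u|.
  move=> su; apply: row_norm_ub => // b; rewrite !mxE /=.
  rewrite addrAC [X in X + _]addrAC subrr add0r.
  have [->|ba] := eqVneq b a.
    by rewrite ltnn add0r mulr1; exact: le_trans su (row_norm_lb _ _).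
  rewrite mulr0 addr0; case: ifP => _; last by rewrite normr0.
  exact: row_norm_lb.
have [|s su E] := @MVT_line _ _ f (x + truncation j u) (basis_vec R a) (u 0 a).
  by move=> s su; have [] := fP _ (near_s s su) a.
have [_ Ds] := fP _ (near_s s su) a.
rewrite tS linearD /= addrA.
have -> : linear_form c (u 0 a *: basis_vec R a) = u 0 a * c a.
  rewrite linearZ /= /linear_form (bigD1 a) //= big1 ?addr0 => [|b ba].
    by rewrite mxE !eqxx mul1r.
  by rewrite mxE (negbTE ba) mul0r.
rewrite (_ : _ - _ = (f (x + truncation j u) - f x
    - linear_form c (truncation j u)) + u 0 a * (partial f a
       (x + truncation j u + s *: basis_vec R a) - c a)); last first.
  rewrite mulrBr /partial -E; ring.
apply: le_trans (ler_normD _ _) _.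
rewrite -natr1 mulrDl mulrDl mul1r lerD ?IH 1?ltnW // normrM mulrC.
by apply: ler_pM => //; exact: row_norm_lb.
Qed.

(** [smooth_on] speaks of partial derivatives only. Full differentiability is what makes the
    directional derivative linear in the direction, and allows products and quotients to be treated
    at once. *)
Lemma C1_differentiable (f : 'rV[R]_n -> R) x :
  (\forall y \near x, forall a, derivable f y (basis_vec R a)) ->
  (forall a, {for x, continuous (partial f a)}) ->
  differentiable f x.
Proof.
move=> fP fc; pose c a := partial f a x.
have E : f \o shift x = cst (f x) + linear_form c +o_ (0 : 'rV[R]_n) id.
  apply/eqaddoP => _/posnumP[e].
  (* The n edge errors add up to at most e; the denominator n + 1 is nonzero also for n = 0. *)
  have fc' : \forall y \near x, forall a,
      `|partial f a x - partial f a y| <= e%:num / n.+1%:R.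
    apply: (@filter_forall _ _ (fun a y =>
      `|partial f a x - partial f a y| <= e%:num / n.+1%:R) (nbhs x)) => a.
    move: (fc a) => /cvgrPdist_le; apply.
    by rewrite divr_gt0.
  have [d /= d0 dP'] := (nbhs_normP _ _).1 (filterI fP fc').
  have dP y : `|x - y| < d -> forall a,
      derivable f y (basis_vec R a) /\ `|partial f a y - c a| <= e%:num / n.+1%:R.
    by move=> /dP'[/= yP yc] a; rewrite distrC; exact: conj (yP a) (yc a).
  have nd : \forall u \near (0 : 'rV[R]_n), `|u| < d.
    by apply/nbhs_normP; exists d => // u; rewrite /ball_ /= sub0r normrN.
  move: nd; apply: filterS => u ud.
  have := @truncation_increment u f x c (e%:num / n.+1%:R) _ n (leqnn n).
  have -> : truncation n u = u by apply/rowP => a; rewrite mxE ltn_ord.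
  move=> H; rewrite -![(_ + _ : _ -> _) _]/(_ + _) /=.
  rewrite -[(- _ : _ -> _) u]/(- _) /= opprD addrA [u + x]addrC.
  apply: le_trans (H _) _; last first.
    rewrite ler_wpM2r // mulrA ler_pdivrMr // mulrC ler_pM2l //.
    by rewrite ler_nat.
  move=> y yu a; apply: dP; rewrite distrC; exact: le_lt_trans ud.
have := diff_unique (@linear_form_continuous c) E => D.
apply/diff_locallyP; rewrite D; split => //.
exact: linear_form_continuous.
Qed.

Lemma differentiable_is_derive (f : 'rV[R]_n -> R) x v : differentiable f x ->
  is_derive x v f (\sum_a v 0 a * partial f a x).
Proof.
move=> fx; apply: DeriveDef; first exact: diff_derivable.
rewrite deriveE // {1}(row_sum_delta v) linear_sum; apply: eq_bigr => a _.
by rewrite linearZ -deriveE.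
Qed.

Lemma smooth_on_partial (V : normedModType R) U (f : 'rV[R]_n -> V) a :
  smooth_on U f -> smooth_on U (partial f a).
Proof. by move=> fU s x Ux; exact: (fU (a :: s)). Qed.

Lemma smooth_on_subset (V : normedModType R) (U1 U2 : set 'rV[R]_n)
    (f : 'rV[R]_n -> V) : U1 `<=` U2 -> smooth_on U2 f -> smooth_on U1 f.
Proof. by move=> U12 fU s x /U12; exact: fU. Qed.

Lemma smooth_on_continuous (V : normedModType R) U (f : 'rV[R]_n -> V) x :
  smooth_on U f -> U x -> {for x, continuous f}.
Proof. by move=> fU /(fU [::])[]. Qed.

Lemma smooth_on_derivable (V : normedModType R) U (f : 'rV[R]_n -> V) x a :
  smooth_on U f -> U x -> derivable f x (basis_vec R a).
Proof. by move=> fU /(fU [::])[_]. Qed.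

Lemma smooth_on_differentiable U (f : 'rV[R]_n -> R) x :
  open U -> smooth_on U f -> U x -> differentiable f x.
Proof.
move=> oU fU Ux; apply: C1_differentiable => [|a].
  by move: (open_nbhs_nbhs (conj oU Ux)); apply: filterS => y Uy a;
     exact: smooth_on_derivable Uy.
exact: smooth_on_continuous (smooth_on_partial a fU) Ux.
Qed.

Lemma smooth_on_schwarz U (f : 'rV[R]_n -> R) x a b :
  open U -> smooth_on U f -> U x ->
  partial (partial f a) b x = partial (partial f b) a x.
Proof.
move=> oU fU Ux; have nU := open_nbhs_nbhs (conj oU Ux).
have pU c := smooth_on_partial c fU.
have ppU c d := smooth_on_partial d (pU c).
apply: (@schwarz _ _ f x (basis_vec R a) (basis_vec R b)).
- by apply: filterS nU => y Uy; exact: smooth_on_derivable Uy.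
- by apply: filterS nU => y Uy; exact: smooth_on_derivable Uy.
- by apply: filterS nU => y Uy; exact: smooth_on_derivable (pU a) Uy.
- by apply: filterS nU => y Uy; exact: smooth_on_derivable (pU b) Uy.
- exact: (smooth_on_continuous (ppU a b) Ux).
- exact: (smooth_on_continuous (ppU b a) Ux).
Qed.

(** Iterated derivatives commute with taking an entry at the points of U; openness turns this into
    an identity near each point, as the next derivative requires. *)
Lemma smooth_on_entry p q U (f : 'rV[R]_n -> 'M[R]_(p, q)) i j :
  open U -> smooth_on U f -> smooth_on U (fun x => f x i j).
Proof.
move=> oU fU.
have E s x : U x ->
    foldl (@partial R n _) (fun x => f x i j) s x = foldl (@partial R n _) f s x i j.
  elim/last_ind: s x => [//|s a IH] x Ux; rewrite !foldl_rcons.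
  rewrite /partial derive_mx; last exact: (fU s x Ux).2.
  rewrite mxE; apply: near_eq_derive.
  by apply: filterS (open_nbhs_nbhs (conj oU Ux)) => y; exact: IH.
move=> s x Ux; have [sc sd] := fU s x Ux.
have nE : \forall y \near x, foldl (@partial R n _) f s y i j =
    foldl (@partial R n _) (fun x => f x i j) s y.
  by apply: filterS (open_nbhs_nbhs (conj oU Ux)) => y Uy; rewrite E.
split=> [|a]; last first.
  by apply: near_eq_derivable nE _; move: (sd a) => /derivable_mxP.
rewrite /prop_for /continuous_at E //.
apply: cvg_trans; first exact: near_eq_cvg nE.
exact: continuous_comp sc (@coord_continuous R p q i j _).
Qed.

Lemma partial_entry p q U (f : 'rV[R]_n -> 'M[R]_(p, q)) i j a x :
  smooth_on U f -> U x -> partial (fun x => f x i j) a x = partial f a x i j.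
Proof.
move=> fU Ux; rewrite /partial derive_mx ?mxE //.
exact: smooth_on_derivable Ux.
Qed.

Lemma smooth_on_cst (V : normedModType R) U (c : V) :
  smooth_on U (fun _ : 'rV[R]_n => c).
Proof.
have E s : exists c', foldl (@partial R n V) (fun=> c) s = fun=> c'.
  elim: s c => [|a s IH] c'; first by exists c'.
  have -> : foldl (@partial R n V) (fun=> c') (a :: s) =
            foldl (@partial R n V) (fun=> 0) s.
    by rewrite /=; congr foldl; apply/funext => y; exact: derive_cst.
  exact: IH.
move=> s x _; have [c' ->] := E s; split=> [|a]; first exact: cst_continuous.
exact: derivable_cst.
Qed.

End Smooth.
(** * Chain rule on the half-line and derivatives of matrices *)

Section HalfLineChainRule.
Context {R : realType} {V : normedModType R}.

Lemma line_cvg (z e : V) : (fun t : R => t *: e + z) @ 0^' --> z.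
Proof.
have c : {for 0, continuous (fun t : R => t *: e + z)}.
  apply: continuousD; last exact: cst_continuous.
  exact: scalel_continuous.
by move/continuous_withinNx: c; rewrite scale0r add0r.
Qed.

(** Here phi has a derivative at r z only relative to D, where r stays. The quotient [q] of phi,
    completed by q(0) = l, is continuous at 0 relative to D, and the quotient of the composite is
    q(k t) times k t / t, also when the increment k t vanishes. *)
Lemma is_derive_comp_within (phi : R -> R) (D : set R) (l : R) (r : V -> R)
    (z e : V) (dr : R) :
  (h^-1 * (phi (r z + h) - phi (r z)))
    @[h --> within [set h : R | D (r z + h)] 0^'] --> l ->
  (\forall y \near z, D (r y)) -> is_derive z e r dr ->
  is_derive z e (fun y => phi (r y)) (l * dr).
Proof.
move=> phiP rD [rd drE].
pose q (s : R) := if s == 0 then l else s^-1 * (phi (r z + s) - phi (r z)).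
have qc : q @ within [set s | D (r z + s)] (nbhs 0) --> l.
  apply/cvgrPdist_le => eps eps0.
  move/cvgrPdist_le: phiP => /(_ _ eps0).
  rewrite !near_withinE => H; near=> s => s0; rewrite /q.
  have [//|sN0] := eqVneq s 0; first by rewrite subrr normr0 ltW.
  by move: sN0 s0; near: s; exact: H.
pose k (t : R) := r (t *: e + z) - r z.
have kd : (fun t => t^-1 *: k t) @ 0^' --> dr by rewrite -drE; exact: rd.
have k0 : k @ 0^' --> 0.
  have : (fun t : R => t *: (t^-1 *: k t)) @ 0^' --> 0 *: dr.
    by apply: cvgZ kd; exact: nbhs_dnbhs.
  rewrite scale0r; apply: cvg_trans; apply: near_eq_cvg.
  near=> t; rewrite scalerA divff ?scale1r //.
  by near: t; exact: nbhs_dnbhs_neq.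
have kp : \forall t \near 0^', D (r z + k t).
  have : \forall t \near 0^', D (r (t *: e + z)) by exact: (@line_cvg z e _ rD).
  by apply: filterS => t; rewrite /k addrCA subrr addr0.
have qk : (q \o k) @ 0^' --> l.
  apply: cvg_comp qc => A.
  rewrite /within /= => nA.
  have kA : \forall t \near 0^', D (r z + k t) -> A (k t).
    exact: (k0 _ nA).
  by move: kp kA; apply: filterS2 => t t0; apply.
have E : (fun t : R => t^-1 *: (phi (r (t *: e + z)) - phi (r z))) @ 0^' -->
    l * dr.
  have : (fun t => q (k t) * (t^-1 *: k t)) @ 0^' --> l * dr by exact: cvgM qk kd.
  apply: cvg_trans; apply: near_eq_cvg.
  near=> t; rewrite /= /q.
  have [kt0|kt0] := eqVneq (k t) 0.
    have -> : r (t *: e + z) = r z by apply/eqP; rewrite -subr_eq0 -/(k t) kt0.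
    by rewrite kt0 scaler0 mulr0 subrr scaler0.
  have -> : r z + k t = r (t *: e + z) by rewrite /k addrCA subrr addr0.
  by rewrite /GRing.scale /= mulrC -mulrA mulVKf.
by apply: DeriveDef; [apply: cvgP E|exact: cvg_lim E].
Unshelve. all: by end_near. Qed.

Lemma is_derive_halfline_comp (phi : R -> R) (r : V -> R) (z e : V) (dr : R) :
  cvg (halfline_quotient phi (r z)) -> (\forall y \near z, 0 <= r y) ->
  is_derive z e r dr ->
  is_derive z e (fun y => phi (r y)) (halfline_derive phi (r z) * dr).
Proof.
move=> phiP r0 rd.
exact: (@is_derive_comp_within phi [set s | 0 <= s] _ r z e dr phiP r0 rd).
Qed.

Lemma is_derive_comp1 (F : R -> R) (f : V -> R) (z e : V) (dF df : R) :
  is_derive (f z) (1 : R) F dF -> is_derive z e f df ->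
  is_derive z e (fun y => F (f y)) (dF * df).
Proof.
move=> [FP <-] fd; apply: (@is_derive_comp_within F setT) fd; last first.
  by apply: nearW.
have : (fun s : R => s^-1 *: ((F \o shift (f z)) (s *: 1) - F (f z))) @ 0^'
    --> 'D_1 F (f z) by exact: FP.
have -> : (fun s : R => s^-1 *: ((F \o shift (f z)) (s *: 1) - F (f z))) =
    (fun s => s^-1 * (F (f z + s) - F (f z))).
  by apply/funext => s /=; rewrite [s *: 1]mulr1 [s + _]addrC.
by apply: cvg_trans; apply: cvg_app; exact: cvg_within.
Qed.

End HalfLineChainRule.

Section MatrixDerivatives.
Context {R : realType} {V : normedModType R}.
Implicit Types (z e : V).

(** Entrywise, so that the matrix product rule reduces to the scalar one and the derivative of an
    entry is obtained by application to its indices. *)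
Definition is_derive_mx p q (M : V -> 'M[R]_(p, q)) z e (B : 'M[R]_(p, q)) :=
  forall i j, is_derive z e (fun y => M y i j) (B i j).

Lemma is_derive_mx_derive p q (M : V -> 'M[R]_(p, q)) z e B :
  is_derive_mx M z e B -> is_derive z e M B.
Proof.
move=> MB; have dM : derivable M z e by apply/derivable_mxP => i j; case: (MB i j).
by apply: DeriveDef => //; rewrite derive_mx //; apply/matrixP => i j;
  rewrite mxE; exact: derive_val.
Qed.

Lemma is_derive_mx_eq p q (M : V -> 'M[R]_(p, q)) z e B B' :
  is_derive_mx M z e B -> B = B' -> is_derive_mx M z e B'.
Proof. by move=> ? <-. Qed.

Lemma is_derive_mx_near p q (M N : V -> 'M[R]_(p, q)) z e B :
  (\forall y \near z, M y = N y) -> is_derive_mx M z e B ->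
  is_derive_mx N z e B.
Proof.
move=> MN MB i j; apply: near_eq_is_derive (MB i j).
by apply: filterS MN => y ->.
Qed.

Lemma is_derive_mx_cst p q (C : 'M[R]_(p, q)) z e :
  is_derive_mx (fun=> C) z e 0.
Proof. by move=> i j; rewrite mxE; exact: is_derive_pcst. Qed.

Lemma is_derive_mxD p q (M N : V -> 'M[R]_(p, q)) z e B C :
  is_derive_mx M z e B -> is_derive_mx N z e C ->
  is_derive_mx (fun y => M y + N y) z e (B + C).
Proof.
move=> MB NC i j; rewrite mxE; under eq_fun do rewrite mxE.
exact: is_derive_pD.
Qed.

Lemma is_derive_mxN p q (M : V -> 'M[R]_(p, q)) z e B :
  is_derive_mx M z e B -> is_derive_mx (fun y => - M y) z e (- B).
Proof.
move=> MB i j; rewrite mxE; under eq_fun do rewrite mxE.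
exact: is_derive_pN.
Qed.

Lemma is_derive_mxZ p q (f : V -> R) (M : V -> 'M[R]_(p, q)) z e df B :
  is_derive z e f df -> is_derive_mx M z e B ->
  is_derive_mx (fun y => f y *: M y) z e (df *: M z + f z *: B).
Proof.
move=> fd MB i j; rewrite !mxE; under eq_fun do rewrite mxE.
exact: is_derive_pM.
Qed.

Lemma is_derive_mxM p q s (M : V -> 'M[R]_(p, q)) (N : V -> 'M[R]_(q, s))
    z e B C :
  is_derive_mx M z e B -> is_derive_mx N z e C ->
  is_derive_mx (fun y => M y *m N y) z e (B *m N z + M z *m C).
Proof.
move=> MB NC i j; under eq_fun do rewrite mxE.
rewrite !mxE -big_split /=; apply: is_derive_psum => c.
exact: is_derive_pM.
Qed.

Lemma is_derive_mxT p q (M : V -> 'M[R]_(p, q)) z e B :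
  is_derive_mx M z e B -> is_derive_mx (fun y => (M y)^T) z e B^T.
Proof. by move=> MB i j; rewrite mxE; under eq_fun do rewrite mxE. Qed.

Lemma is_derive_mx_block p q p' q' (M : V -> 'M[R]_(p, q))
    (N : V -> 'M[R]_(p, q')) (P : V -> 'M[R]_(p', q)) (Q : V -> 'M[R]_(p', q'))
    z e A B C D :
  is_derive_mx M z e A -> is_derive_mx N z e B ->
  is_derive_mx P z e C -> is_derive_mx Q z e D ->
  is_derive_mx (fun y => block_mx (M y) (N y) (P y) (Q y)) z e
    (block_mx A B C D).
Proof.
move=> MA NB PC QD i j.
case: (split_ordP i) => i' ->; case: (split_ordP j) => j' ->.
- by rewrite block_mxEul; under eq_fun do rewrite block_mxEul.
- by rewrite block_mxEur; under eq_fun do rewrite block_mxEur.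
- by rewrite block_mxEdl; under eq_fun do rewrite block_mxEdl.
- by rewrite block_mxEdr; under eq_fun do rewrite block_mxEdr.
Qed.

End MatrixDerivatives.

(** * Base and fibre coordinates on the total space *)

Section ProductCoordinates.
Context {R : realType} {m k : nat}.
Implicit Types z e : 'rV[R]_(m + k).

Lemma is_derive_lsubmx (f : 'rV[R]_m -> R) z e df :
  is_derive (lsubmx z) (lsubmx e) f df ->
  is_derive z e (fun y => f (lsubmx y)) df.
Proof.
have E : (fun h : R => h^-1 *: (((fun y => f (lsubmx y)) \o shift z) (h *: e)
            - f (lsubmx z))) =
         (fun h : R => h^-1 *: ((f \o shift (lsubmx z)) (h *: lsubmx e)
            - f (lsubmx z))).
  by apply/funext => h /=; rewrite !linearD !linearZ.
move=> [fd <-]; apply: DeriveDef; first by rewrite /derivable E.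
by rewrite /derive E.
Qed.

Lemma is_derive_mx_lsubmx p q (f : 'rV[R]_m -> 'M[R]_(p, q)) z e B :
  is_derive_mx f (lsubmx z) (lsubmx e) B ->
  is_derive_mx (fun y => f (lsubmx y)) z e B.
Proof. by move=> fB i j; exact: (@is_derive_lsubmx (fun x => f x i j)). Qed.

Lemma is_derive_mx_rsubmx z e : is_derive_mx (@rsubmx R 1 m k) z e (rsubmx e).
Proof.
move=> i j; apply: DeriveDef.
  apply/cvg_ex; exists (rsubmx e i j); apply: cvg_near_cst.
  near=> t; rewrite /= !mxE addrK /GRing.scale /= mulrA mulVf ?mul1r //.
  by near: t; exact: nbhs_dnbhs_neq.
apply: cvg_lim => //; apply: cvg_near_cst.
near=> t; rewrite /= !mxE addrK /GRing.scale /= mulrA mulVf ?mul1r //.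
by near: t; exact: nbhs_dnbhs_neq.
Unshelve. all: by end_near. Qed.

(** A line in a horizontal direction stays in the zero section, so only the restriction of f to it
    matters. *)
Lemma is_derive_zero_section (f : 'rV[R]_(m + k) -> R) x u df :
  is_derive x u (fun y => f (row_mx y 0)) df ->
  is_derive (row_mx x 0) (row_mx u 0) f df.
Proof.
have E : (fun h : R => h^-1 *: ((f \o shift (row_mx x 0)) (h *: row_mx u 0)
            - f (row_mx x 0))) =
         (fun h : R => h^-1 *: (((fun y => f (row_mx y 0)) \o shift x) (h *: u)
            - f (row_mx x 0))).
  by apply/funext => h /=; rewrite scale_row_mx scaler0 add_row_mx addr0.
move=> [fd <-]; apply: DeriveDef; first by rewrite /derivable E.
by rewrite /derive E.
Qed.

Lemma near_lsubmx (P : set 'rV[R]_m) z : (\forall x \near lsubmx z, P x) ->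
  \forall y \near z, P (lsubmx y).
Proof.
move=> nP; have := differentiable_continuous (differentiable_lsubmx (m:=1) z).
by move=> /(_ _ nP).
Qed.

End ProductCoordinates.
(** * The Ricci tensor in coordinates *)

Section RicciCoordinates.
Context {R : realType} {n : nat}.
Variable G : 'rV[R]_n -> 'M[R]_n.
Implicit Types (x u v : 'rV[R]_n).
Local Notation Gam a b c := (fun y => christoffel G y a b c).
Local Notation e_ a := (basis_vec R a).

Definition christoffel_form x u v (c : 'I_n) : R :=
  \sum_(a < n) \sum_(b < n) christoffel G x a b c * u 0 a * v 0 b.

(** The classical d_a Gamma^a_ij - d_i Gamma^a_aj + Gamma^a_ab Gamma^b_ij - Gamma^a_ib
    Gamma^b_aj. *)
Definition ricci_coord x (i j : 'I_n) : R :=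
  \sum_a ('D_(e_ a) (Gam i j a) x - 'D_(e_ i) (Gam a j a) x +
    \sum_b (christoffel G x a b a * christoffel G x i j b -
            christoffel G x i b a * christoffel G x a j b)).

Lemma basis_vecE (a b : 'I_n) : (e_ a) 0 b = (b == a)%:R.
Proof. by rewrite mxE eqxx. Qed.

Lemma sum_basis_vec (F : 'I_n -> R) a : \sum_b (e_ a) 0 b * F b = F a.
Proof.
rewrite (bigD1 a) //= basis_vecE eqxx mul1r big1 ?addr0 // => b ba.
by rewrite basis_vecE (negbTE ba) mul0r.
Qed.

Lemma sum_basis_vecr (F : 'I_n -> R) a : \sum_b F b * (e_ a) 0 b = F a.
Proof. by under eq_bigr do rewrite mulrC; exact: sum_basis_vec. Qed.

Lemma christoffel_form_basis x a v c :
  christoffel_form x (e_ a) v c = \sum_b christoffel G x a b c * v 0 b.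
Proof.
rewrite /christoffel_form exchange_big /=; apply: eq_bigr => b _.
rewrite -big_distrl /=; congr (_ * _).
exact: (sum_basis_vecr (fun a => christoffel G x a b c)).
Qed.

Lemma levi_civita_cst u v :
  levi_civita G (cst u) (cst v) = fun x => \row_c christoffel_form x u v c.
Proof. by apply/funext => x; rewrite /levi_civita derive_cst add0r. Qed.

Lemma levi_civita_cstl u (Y : 'rV[R]_n -> 'rV[R]_n) x : levi_civita G (cst u) Y x =
  'D_u Y x + \row_c christoffel_form x u (Y x) c.
Proof. by []. Qed.

Lemma levi_civita_bracket_cst u v (Z : 'rV[R]_n -> 'rV[R]_n) x :
  levi_civita G (lie_bracket (cst u) (cst v)) Z x = 0.
Proof.
rewrite /levi_civita /lie_bracket !derive_cst subrr derive0 add0r.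
apply/rowP => c; rewrite !mxE big1 // => a _; rewrite big1 // => b _.
by rewrite mxE mulr0 mul0r.
Qed.

Lemma is_derive_christoffel_form x w u v c (d : 'I_n -> 'I_n -> R) :
  (forall a b, is_derive x w (Gam a b c) (d a b)) ->
  is_derive x w (fun y => christoffel_form y u v c)
    (\sum_a \sum_b d a b * u 0 a * v 0 b).
Proof.
move=> dP; apply: is_derive_psum => a; apply: is_derive_psum => b.
by do 2 apply: is_derive_pMr.
Qed.

(** The second hypothesis, linearity of the derivative in u, does not follow from the existence of
    partial derivatives. It holds on M, where the Christoffel symbols are differentiable. *)
Lemma ricci_cst u v x :
  (forall l a b c, derivable (Gam a b c) x (e_ l)) ->
  (forall a b c, is_derive x u (Gam a b c)
                   (\sum_l u 0 l * 'D_(e_ l) (Gam a b c) x)) ->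
  ricci G (cst u) (cst v) x = \sum_i \sum_j u 0 i * v 0 j * ricci_coord x i j.
Proof.
move=> dG duG.
have deriv_row w u' v' : (forall a b c, derivable (Gam a b c) x w) ->
    is_derive_mx (fun y => \row_c christoffel_form y u' v' c) x w
      (\row_c \sum_a \sum_b 'D_w (Gam a b c) x * u' 0 a * v' 0 b).
  move=> dw i c; rewrite mxE; under eq_fun do rewrite mxE.
  by apply: is_derive_christoffel_form => a b; exact: derivableP.
have cE a : curvature G (cst (e_ a)) (cst u) (cst v) x 0 a =
    (\sum_i \sum_j 'D_(e_ a) (Gam i j a) x * u 0 i * v 0 j) +
    \sum_b christoffel G x a b a * christoffel_form x u v b -
    ((\sum_j (\sum_i u 0 i * 'D_(e_ i) (Gam a j a) x) * v 0 j) +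
     \sum_i \sum_b christoffel G x i b a * u 0 i *
        (\sum_j christoffel G x a j b * v 0 j)).
  rewrite /curvature levi_civita_bracket_cst subr0 !levi_civita_cst.
  rewrite !levi_civita_cstl.
  rewrite (@derive_val _ _ _ _ _ _ _ (is_derive_mx_derive (deriv_row _ _ _ _))) //.
  rewrite (@derive_val _ _ _ _ _ _ _ (is_derive_mx_derive (deriv_row u _ _ _))); last first.
    by move=> a' b c; case: (duG a' b c).
  rewrite !mxE christoffel_form_basis; congr (_ + _ - (_ + _)).
  - by apply: eq_bigr => b _; rewrite mxE.
  - rewrite exchange_big /=; apply: eq_bigr => j _.
    rewrite -big_distrl /=; congr (_ * _).
    rewrite (sum_basis_vecr (fun i => 'D_u (Gam i j a) x)).
    exact: derive_val.
  - apply: eq_bigr => i _; apply: eq_bigr => b _.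
    by rewrite mxE christoffel_form_basis.
rewrite /ricci; under eq_bigr do rewrite cE.
rewrite /ricci_coord.
under [RHS]eq_bigr => i _.
  under eq_bigr => j _ do rewrite big_distrr /=.
  rewrite exchange_big; over.
rewrite [RHS]exchange_big /=; apply: eq_bigr => a _.
rewrite opprD.
under [X in _ + X + _]eq_bigr => b _.
  rewrite big_distrr /=; under eq_bigr => i _ do rewrite big_distrr /=.
  over.
rewrite [X in _ + X + _]exchange_big /=.
under [X in _ + X + _]eq_bigr => i _ do rewrite exchange_big /=.
under [X in - X]eq_bigr => j _ do rewrite big_distrl /=.
rewrite [X in - X]exchange_big /=.
under [X in _ + _ + (_ - X)]eq_bigr => i _.
  under eq_bigr => b _ do rewrite big_distrr /=.
  rewrite exchange_big; over.
rewrite -!sumrN -!big_split /=; apply: eq_bigr => i _.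
rewrite -!sumrN -!big_split /=; apply: eq_bigr => j _.
rewrite mulrDr big_distrr /=.
under [X in _ = _ + X]eq_bigr => b _ do rewrite mulrBr.
rewrite sumrB.
have -> : \sum_b christoffel G x a b a * (christoffel G x i j b * u 0 i * v 0 j) =
    \sum_b u 0 i * v 0 j * (christoffel G x a b a * christoffel G x i j b).
  by apply: eq_bigr => b _; ring.
have -> : \sum_b christoffel G x i b a * u 0 i * (christoffel G x a j b * v 0 j) =
    \sum_b u 0 i * v 0 j * (christoffel G x i b a * christoffel G x a j b).
  by apply: eq_bigr => b _; ring.
move: ('D_(e_ a) (Gam i j a) x) ('D_(e_ i) (Gam a j a) x) => A B.
move: (\sum_b u 0 i * v 0 j * (_ * christoffel G x i j b)).
move: (\sum_b u 0 i * v 0 j * (_ * christoffel G x a j b)) => S T.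
ring.
Qed.

(** For coordinate vectors partial derivatives suffice; this version serves on E, where nothing more
    is known at the zero section. *)
Lemma ricci_basis x i j :
  (forall l a b c, derivable (Gam a b c) x (e_ l)) ->
  ricci G (cst (e_ i)) (cst (e_ j)) x = ricci_coord x i j.
Proof.
move=> dG.
have diG a b c : is_derive x (e_ i) (Gam a b c)
    (\sum_l (e_ i) 0 l * 'D_(e_ l) (Gam a b c) x).
  rewrite (sum_basis_vec (fun l => 'D_(e_ l) (Gam a b c) x)).
  exact: derivableP.
rewrite (ricci_cst (e_ j) dG diG).
under eq_bigr => p _ do under eq_bigr => q _ do rewrite -mulrA.
under eq_bigr => p _ do rewrite -mulr_sumr sum_basis_vec.
by rewrite (sum_basis_vec (fun p => ricci_coord x p j)).
Qed.

Lemma bilin_sum (A : 'M[R]_n) u v :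
  bilin A u v = \sum_i \sum_j u 0 i * v 0 j * A i j.
Proof.
rewrite /bilin mxE exchange_big; apply: eq_bigr => j _.
rewrite !mxE big_distrl; apply: eq_bigr => i _ /=; ring.
Qed.

(** The identity Gamma^a_ab = (1/2) tr (G^-1 d_b G): the other two terms of the Koszul bracket are
    exchanged by a <-> d and cancel against the symmetric inverse. *)
Lemma christoffel_trace x b : (G x)^T = G x ->
  (forall a c d, partial (fun y => G y c d) a x = partial (fun y => G y d c) a x) ->
  \sum_a christoffel G x a b a =
  2^-1 * \sum_a \sum_d invmx (G x) a d * partial (fun y => G y a d) b x.
Proof.
move=> GT GS; rewrite /christoffel -big_distrr /=; congr (_ * _).
have iT a d : invmx (G x) a d = invmx (G x) d a.
  by rewrite -[in LHS]GT -trmx_inv mxE.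
under eq_bigr do (under eq_bigr do rewrite mulrBr mulrDr; rewrite sumrB big_split /=).
rewrite sumrB big_split /= addrAC.
rewrite [X in X - _ + _](_ : _ = \sum_a \sum_d invmx (G x) a d *
    partial (fun y => G y a b) d x).
  by rewrite subrr add0r.
rewrite exchange_big /=; apply: eq_bigr => a _; apply: eq_bigr => d _.
by rewrite iT GS.
Qed.

End RicciCoordinates.

(** * Differentiability of determinants and cofactors *)

Section InverseMatrix.
Context {R : realType} {V : normedModType R}.

Lemma differentiable_psum (I : finType) (P : pred I) (f : I -> V -> R) x :
  (forall i, differentiable (f i) x) ->
  differentiable (fun y => \sum_(i | P i) f i y) x.
Proof.
move=> fP; rewrite -fct_sumE; elim/big_ind: _ => [|g h gx hx|i _].
- exact: (@differentiable_cst _ _ _ (0 : R) x).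
- exact: differentiableD.
- exact: fP.
Qed.

Lemma differentiable_pprod (I : finType) (f : I -> V -> R) x :
  (forall i, differentiable (f i) x) ->
  differentiable (fun y => \prod_i f i y) x.
Proof.
move=> fP; rewrite -fct_prodE; elim/big_ind: _ => [|g h gx hx|i _].
- exact: (@differentiable_cst _ _ _ (1 : R) x).
- exact: differentiableM.
- exact: fP.
Qed.

Lemma differentiable_det p (M : V -> 'M[R]_p) x :
  (forall i j, differentiable (fun y => M y i j) x) ->
  differentiable (fun y => \det (M y)) x.
Proof.
move=> MP; apply: differentiable_psum => s.
apply: (@differentiableM _ _ (fun=> _)); first exact: differentiable_cst.
by apply: differentiable_pprod => i.
Qed.

Lemma differentiable_cofactor p (M : V -> 'M[R]_p) x i j :
  (forall i j, differentiable (fun y => M y i j) x) ->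
  differentiable (fun y => cofactor (M y) i j) x.
Proof.
move=> MP; apply: (@differentiableM _ _ (fun=> _)); first exact: differentiable_cst.
by apply: differentiable_det => a b; under eq_fun do rewrite !mxE.
Qed.

End InverseMatrix.

(** * Positive definite Gram matrices *)

Section PositiveDefinite.
Context {R : realType} {n : nat}.
Implicit Types A : 'M[R]_n.

Lemma positive_definite_unitmx A : positive_definite A -> A \in unitmx.
Proof.
move=> [_ Apos]; rewrite -row_free_unit -kermx_eq0.
apply/rowV0P => u /sub_kermxP uA; apply/eqP; apply: contraT => /Apos.
by rewrite /bilin uA mul0mx mxE ltxx.
Qed.

Lemma bilin_basis A a b : bilin A (basis_vec R a) (basis_vec R b) = A a b.
Proof.
by rewrite bilin_sum; under eq_bigr => i _ do
  (under eq_bigr => j _ do rewrite -mulrA; rewrite -mulr_sumr sum_basis_vec);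
  rewrite sum_basis_vec.
Qed.

Lemma positive_definite_diag A a : positive_definite A -> 0 < A a a.
Proof.
move=> [_ Apos]; rewrite -bilin_basis; apply: Apos.
by apply/eqP => /rowP/(_ a); rewrite basis_vecE mxE eqxx => /eqP; rewrite oner_eq0.
Qed.

Lemma positive_definite_bilin_ge0 A u : positive_definite A -> 0 <= bilin A u u.
Proof.
move=> [_ Apos]; have [->|/Apos/ltW//] := eqVneq u 0.
by rewrite /bilin !mul0mx mxE.
Qed.

End PositiveDefinite.

(** * Christoffel symbols and the Einstein equation on an open domain *)

Section RiemannianDomain.
Context {R : realType} {n : nat}.
Variables (U : set 'rV[R]_n) (g : 'rV[R]_n -> 'M[R]_n).
Hypotheses (oU : open U) (gU : smooth_on U g)
  (g_pos : forall x, U x -> positive_definite (g x)).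
Local Notation Gam a b c := (fun y => christoffel g y a b c).

(** By Cramer's rule the inverse of g is its transposed cofactors over the determinant, so near x
    the symbol is a rational expression [F] in g and its first derivatives, hence differentiable. *)
Lemma christoffel_is_derive x u a b c : U x ->
  is_derive x u (Gam a b c) (\sum_l u 0 l * 'D_(basis_vec R l) (Gam a b c) x).
Proof.
move=> Ux.
have gd i j : differentiable (fun y => g y i j) x.
  by apply: smooth_on_differentiable (smooth_on_entry i j oU gU) Ux.
have dgd i j l : differentiable (partial (fun y => g y i j) l) x.
  apply: smooth_on_differentiable Ux => //.
  by apply: smooth_on_partial; exact: smooth_on_entry.
pose F y := 2^-1 * \sum_d ((\det (g y))^-1 * cofactor (g y) d c *
  (partial (fun y => g y b d) a y + partial (fun y => g y a d) b y
   - partial (fun y => g y a b) d y)).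
have FG : \forall y \near x, F y = christoffel g y a b c.
  apply: filterS (open_nbhs_nbhs (conj oU Ux)) => y Uy.
  rewrite /F /christoffel; congr (_ * _); apply: eq_bigr => d _.
  by rewrite /invmx (positive_definite_unitmx (g_pos Uy)) !mxE.
have Fd : differentiable F x.
  apply: (@differentiableM _ _ (fun=> _)); first exact: differentiable_cst.
  apply: differentiable_psum => d; apply: differentiableM.
    apply: differentiableM; last exact: differentiable_cofactor.
    apply: differentiableV; first exact: differentiable_det.
    have := positive_definite_unitmx (g_pos Ux).
    by rewrite unitmxE unitfE.
  by apply: differentiableB; first apply: differentiableD.
have FE v : is_derive x v (Gam a b c) (\sum_l v 0 l * partial F l x).
  exact: near_eq_is_derive FG (differentiable_is_derive v Fd).
apply: is_derive_peq (FE u) _; apply: eq_bigr => l _; congr (_ * _).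
by rewrite (@derive_val _ _ _ _ _ _ _ (FE _)) sum_basis_vec.
Qed.

Lemma christoffel_derivable x l a b c : U x ->
  derivable (Gam a b c) x (basis_vec R l).
Proof. by move=> Ux; case: (christoffel_is_derive (basis_vec R l) a b c Ux). Qed.

Lemma einstein_on_coord lambda :
  (forall x, U x -> forall i j, ricci_coord g x i j = lambda * g x i j) ->
  einstein_on g U lambda.
Proof.
move=> E x Ux u v.
have Gd l a b c := @christoffel_derivable x l a b c Ux.
have Gu a b c := @christoffel_is_derive x u a b c Ux.
rewrite (ricci_cst v Gd Gu).
rewrite bilin_sum mulr_sumr; apply: eq_bigr => i _.
by rewrite mulr_sumr; apply: eq_bigr => j _; rewrite E // mulrCA.
Qed.

End RiemannianDomain.
(** * The metric on the total space *)

Section Shear.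
Context {R : realType} {m k : nat}.

(* row i is v c_i: for c = w x, the vertical part of the i-th coordinate
   vector at the point (x, v) *)
Definition shear (v : 'rV[R]_k) (c : 'I_m -> 'M[R]_k) : 'M[R]_(m, k) :=
  \matrix_(i, b) (v *m c i) 0 b.

Lemma shear0l c : shear 0 c = 0.
Proof. by apply/matrixP => i b; rewrite !mxE big1 // => a _; rewrite mxE mul0r. Qed.

Lemma shear0r v : shear v (fun=> 0) = 0.
Proof. by apply/matrixP => i b; rewrite mxE mulmx0 !mxE. Qed.

Lemma row_shear v c i : row i (shear v c) = v *m c i.
Proof. by apply/rowP => b; rewrite !mxE. Qed.

Lemma shear_basis c a i b : shear (basis_vec R a) c i b = c i a b.
Proof. by rewrite mxE -rowE mxE. Qed.

Lemma is_derive_mx_shear {V : normedModType R} (M : V -> 'rV[R]_k)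
    (N : V -> 'I_m -> 'M[R]_k) z e B C :
  is_derive_mx M z e B -> (forall i, is_derive_mx (N^~ i) z e (C i)) ->
  is_derive_mx (fun y => shear (M y) (N y)) z e (shear B (N z) + shear (M z) C).
Proof.
move=> MB NC i b.
have -> : (shear B (N z) + shear (M z) C) i b = (B *m N z i + M z *m C i) 0 b.
  by rewrite !mxE.
under eq_fun do rewrite mxE.
exact: (is_derive_mxM MB (NC i)).
Qed.

End Shear.

Lemma lsubmx_basisl (R : realType) m k (i : 'I_m) :
  lsubmx (basis_vec R (lshift k i)) = basis_vec R i.
Proof. by apply/rowP => a; rewrite !mxE eq_lshift. Qed.

Lemma rsubmx_basisl (R : realType) m k (i : 'I_m) :
  rsubmx (basis_vec R (lshift k i)) = 0 :> 'rV_k.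
Proof. by apply/rowP => a; rewrite !mxE eq_rlshift andbF. Qed.

Lemma lsubmx_basisr (R : realType) m k (i : 'I_k) :
  lsubmx (basis_vec R (rshift m i)) = 0 :> 'rV_m.
Proof. by apply/rowP => a; rewrite !mxE eq_lrshift andbF. Qed.

Lemma rsubmx_basisr (R : realType) m k (i : 'I_k) :
  rsubmx (basis_vec R (rshift m i)) = basis_vec R i.
Proof. by apply/rowP => a; rewrite !mxE eq_rshift. Qed.

Lemma is_derive_mx_smooth (R : realType) n p q U (f : 'rV[R]_n -> 'M[R]_(p, q)) x a :
  smooth_on U f -> U x -> is_derive_mx f x (basis_vec R a) (partial f a x).
Proof.
move=> fU Ux i j; rewrite -(partial_entry i j a fU Ux); apply: derivableP.
by move: (smooth_on_derivable (a := a) fU Ux) => /derivable_mxP.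
Qed.

Lemma expRN_mul (R : realType) (y : R) : expR (- y) * expR y = 1.
Proof. by rewrite mulrC -expRD subrr expR0. Qed.

Lemma invmx_unique (R : realType) n (A B : 'M[R]_n) : A *m B = 1%:M -> invmx A = B.
Proof.
move=> AB; have [uA _] := mulmx1_unit AB.
by rewrite -[RHS]mul1mx -(mulVmx uA) -mulmxA AB mulmx1.
Qed.

Section BundleMetric.
Context {R : realType} {m k : nat}.
Variables (g : 'rV[R]_m -> 'M[R]_m) (h : 'rV[R]_m -> 'M[R]_k).
Variables (w : 'rV[R]_m -> 'I_m -> 'M[R]_k) (phi1 phi2 : R -> R).
Local Notation e_ a := (basis_vec R a).
Implicit Types z : 'rV[R]_(m + k).

Definition fibre_sqnorm z := bilin (h (lsubmx z)) (rsubmx z) (rsubmx z).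

Definition vertical_component z (zeta : 'rV[R]_(m + k)) : 'rV[R]_k :=
  rsubmx zeta + rsubmx z *m (\sum_a lsubmx zeta 0 a *: w (lsubmx z) a).

(** Convertible with [total_space_metric] at a pair (i, t) when h is taken to be [h t \o point i];
    the computation thus uses only data on a domain of R^m. *)
Definition bundle_metric z : 'M[R]_(m + k) :=
  \matrix_(a, b)
    (expR (2 * phi1 (fibre_sqnorm z)) *
       bilin (g (lsubmx z)) (lsubmx (e_ a)) (lsubmx (e_ b)) +
     expR (2 * phi2 (fibre_sqnorm z)) *
       bilin (h (lsubmx z)) (vertical_component z (e_ a))
                            (vertical_component z (e_ b))).

Definition cfactor (phi : R -> R) z := expR (2 * phi (fibre_sqnorm z)).
(** Derivative of the conformal factor with respect to r; a coordinate derivative carries the extra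
    factor [fibre_sqnorm' d z]. *)
Definition cfactor' (phi : R -> R) z :=
  cfactor phi z * (2 * halfline_derive phi (fibre_sqnorm z)).

Local Notation gz z := (g (lsubmx z)).
Local Notation hz z := (h (lsubmx z)).
Local Notation W z := (shear (rsubmx z) (w (lsubmx z))).
Local Notation F1 := (cfactor phi1).
Local Notation F2 := (cfactor phi2).
Local Notation F1' := (cfactor' phi1).
Local Notation F2' := (cfactor' phi2).

Lemma vertical_componentl z i : vertical_component z (e_ (lshift k i)) = row i (W z).
Proof.
rewrite /vertical_component rsubmx_basisl lsubmx_basisl add0r row_shear.
congr (_ *m _); rewrite (bigD1 i) //= basis_vecE eqxx scale1r big1 ?addr0 //.
by move=> j ji; rewrite basis_vecE (negbTE ji) scale0r.
Qed.

Lemma vertical_componentr z a : vertical_component z (e_ (rshift m a)) = e_ a.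
Proof.
rewrite /vertical_component rsubmx_basisr lsubmx_basisr big1 ?mulmx0 ?addr0 //.
by move=> j _; rewrite mxE scale0r.
Qed.

Lemma bundle_metricE z : bundle_metric z = block_mx
  (F1 z *: gz z + F2 z *: (W z *m hz z *m (W z)^T)) (F2 z *: (W z *m hz z))
  (F2 z *: (hz z *m (W z)^T)) (F2 z *: hz z).
Proof.
have bl0 n (A : 'M[R]_n) u : bilin A 0 u = 0 by rewrite /bilin !mul0mx mxE.
have br0 n (A : 'M[R]_n) u : bilin A u 0 = 0 by rewrite /bilin trmx0 mulmx0 mxE.
have bW p q s (A : 'M[R]_p) (B : 'M[R]_(q, p)) (C : 'M[R]_(s, p)) i j :
    bilin A (row i B) (row j C) = (B *m A *m C^T) i j.
  by rewrite /bilin -row_mul !mxE; apply: eq_bigr => a _; rewrite !mxE.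
have eW p (i : 'I_p) : e_ i = row i 1%:M.
  by rewrite rowE mulmx1.
apply/matrixP => a b; rewrite mxE -/(cfactor phi1 z) -/(cfactor phi2 z).
case: (split_ordP a) => i ->; case: (split_ordP b) => j ->;
  rewrite ?vertical_componentl ?vertical_componentr ?lsubmx_basisl
    ?lsubmx_basisr ?bl0 ?br0 ?mulr0 ?add0r.
- by rewrite block_mxEul bilin_basis bW [RHS]mxE; congr (_ + _); rewrite [RHS]mxE.
- by rewrite block_mxEur eW bW trmx1 mulmx1 [RHS]mxE.
- by rewrite block_mxEdl eW bW mul1mx [RHS]mxE.
- by rewrite block_mxEdr bilin_basis [RHS]mxE.
Qed.

(** A function pulled back from the base is constant along the fibres. Treating both kinds of
    direction at once lets a single formula give all first derivatives of the metric. *)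
Definition pullback_partial p q (f : 'rV[R]_m -> 'M[R]_(p, q)) (d : 'I_(m + k))
    (x : 'rV[R]_m) : 'M[R]_(p, q) :=
  if fintype.split d is inl l then partial f l x else 0.

Lemma pullback_partiall p q (f : 'rV[R]_m -> 'M[R]_(p, q)) l x :
  pullback_partial f (lshift k l) x = partial f l x.
Proof. by rewrite /pullback_partial (unsplitK (inl _)). Qed.

Lemma pullback_partialr p q (f : 'rV[R]_m -> 'M[R]_(p, q)) a x :
  pullback_partial f (rshift m a) x = 0.
Proof. by rewrite /pullback_partial (unsplitK (inr _)). Qed.

Lemma is_derive_mx_pullback_vertical p q (f : 'rV[R]_m -> 'M[R]_(p, q)) z a :
  is_derive_mx (fun y => f (lsubmx y)) z (e_ (rshift m a)) 0.
Proof.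
apply: is_derive_mx_lsubmx => i j; rewrite lsubmx_basisr mxE; exact: is_derive0.
Qed.

Lemma is_derive_mx_pullback U p q (f : 'rV[R]_m -> 'M[R]_(p, q)) z d :
  smooth_on U f -> U (lsubmx z) ->
  is_derive_mx (fun y => f (lsubmx y)) z (e_ d) (pullback_partial f d (lsubmx z)).
Proof.
move=> fU Uz; case: (split_ordP d) => l ->.
  rewrite pullback_partiall; apply: is_derive_mx_lsubmx.
  by rewrite lsubmx_basisl; exact: is_derive_mx_smooth Uz.
by rewrite pullback_partialr; exact: is_derive_mx_pullback_vertical.
Qed.

Local Notation g' d z := (pullback_partial g d (lsubmx z)).
Local Notation h' d z := (pullback_partial h d (lsubmx z)).
Local Notation w' d z := (fun i => pullback_partial (w^~ i) d (lsubmx z)).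

(* For a coordinate direction d, f' d is the derivative of f along the d-th
   coordinate vector field; f'' e d below is its derivative along the e-th
   vertical direction, at the zero section. *)
Definition shear' (d : 'I_(m + k)) z : 'M[R]_(m, k) :=
  shear (rsubmx (e_ d)) (w (lsubmx z)) + shear (rsubmx z) (w' d z).

Definition fibre_sqnorm' (d : 'I_(m + k)) z : R :=
  ((rsubmx (e_ d) *m hz z + rsubmx z *m h' d z) *m (rsubmx z)^T
   + rsubmx z *m hz z *m (rsubmx (e_ d))^T) 0 0.

Local Notation W' := shear'.
Local Notation r' := fibre_sqnorm'.

Definition bundle_metric' (d : 'I_(m + k)) z : 'M[R]_(m + k) := block_mx
  (F1' z * r' d z *: gz z + F1 z *: g' d z
   + (F2' z * r' d z *: (W z *m hz z *m (W z)^T)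
      + F2 z *: ((W' d z *m hz z + W z *m h' d z) *m (W z)^T
                 + W z *m hz z *m (W' d z)^T)))
  (F2' z * r' d z *: (W z *m hz z)
   + F2 z *: (W' d z *m hz z + W z *m h' d z))
  (F2' z * r' d z *: (hz z *m (W z)^T)
   + F2 z *: (h' d z *m (W z)^T + hz z *m (W' d z)^T))
  (F2' z * r' d z *: hz z + F2 z *: h' d z).

Variable U : set 'rV[R]_m.
Hypotheses (oU : open U) (gU : smooth_on U g) (hU : smooth_on U h)
  (wU : forall i, smooth_on U (w^~ i))
  (g_pos : forall x, U x -> positive_definite (g x))
  (h_pos : forall x, U x -> positive_definite (h x))
  (phi1_smooth : smooth_halfline phi1) (phi2_smooth : smooth_halfline phi2).

Lemma near_base z : U (lsubmx z) -> \forall y \near z, U (lsubmx y).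
Proof. by move=> Uz; apply: near_lsubmx; exact: open_nbhs_nbhs. Qed.

Lemma is_derive_fibre_sqnorm z d : U (lsubmx z) ->
  is_derive z (e_ d) fibre_sqnorm (r' d z).
Proof.
move=> Uz; have rd := is_derive_mx_rsubmx z (e_ d).
have hd := is_derive_mx_pullback d hU Uz.
exact: (is_derive_mxM (is_derive_mxM rd hd) (is_derive_mxT rd) 0 0).
Qed.

(** Positivity of h around z keeps r on the half-line, so phi(r) is differentiable across the zero
    section although phi is so only from the right at 0. *)
Lemma is_derive_halfline_fibre_sqnorm (phi : R -> R) z d : U (lsubmx z) ->
  cvg (halfline_quotient phi (fibre_sqnorm z)) ->
  is_derive z (e_ d) (fun y => phi (fibre_sqnorm y))
    (halfline_derive phi (fibre_sqnorm z) * r' d z).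
Proof.
move=> Uz phiP.
apply: (is_derive_halfline_comp phiP) (is_derive_fibre_sqnorm d Uz).
apply: filterS (near_base Uz) => y Uy.
by apply: positive_definite_bilin_ge0; exact: h_pos.
Qed.

Lemma fibre_sqnorm_ge0 z : U (lsubmx z) -> 0 <= fibre_sqnorm z.
Proof. by move=> Uz; apply: positive_definite_bilin_ge0; exact: h_pos. Qed.

Lemma is_derive_cfactor phi z d : smooth_halfline phi -> U (lsubmx z) ->
  is_derive z (e_ d) (cfactor phi) (cfactor' phi z * r' d z).
Proof.
move=> phiS Uz; have phid := is_derive_halfline_fibre_sqnorm d Uz
  (phiS 0%N _ (fibre_sqnorm_ge0 Uz)).
have := is_derive_comp1 (is_derive_expR _)
  (is_derive_pM (is_derive_pcst 2 z (e_ d)) phid).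
rewrite mul0r add0r => H; apply: is_derive_peq H _.
by rewrite /cfactor' /cfactor !mulrA.
Qed.

Lemma is_derive_bundle_metric z d : U (lsubmx z) ->
  is_derive_mx bundle_metric z (e_ d) (bundle_metric' d z).
Proof.
move=> Uz.
have Wd : is_derive_mx (fun y => W y) z (e_ d) (W' d z).
  apply: is_derive_mx_shear => [|i]; first exact: is_derive_mx_rsubmx.
  exact: is_derive_mx_pullback (wU i) Uz.
have gd := is_derive_mx_pullback d gU Uz.
have hd := is_derive_mx_pullback d hU Uz.
have F1d := is_derive_cfactor d phi1_smooth Uz.
have F2d := is_derive_cfactor d phi2_smooth Uz.
have WTd := is_derive_mxT Wd.
rewrite (funext bundle_metricE).
apply: is_derive_mx_block.
- apply: is_derive_mxD; first exact: is_derive_mxZ.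
  exact: is_derive_mxZ F2d (is_derive_mxM (is_derive_mxM Wd hd) WTd).
- exact: is_derive_mxZ F2d (is_derive_mxM Wd hd).
- exact: is_derive_mxZ F2d (is_derive_mxM hd WTd).
- exact: is_derive_mxZ F2d hd.
Qed.
(** The product P^-T D^-1 P^-1 written out, with P^-1 = (1, -W; 0, 1). *)
Definition bundle_inverse z : 'M[R]_(m + k) :=
  let A := expR (- (2 * phi1 (fibre_sqnorm z))) *: invmx (gz z) in
  let B := expR (- (2 * phi2 (fibre_sqnorm z))) *: invmx (hz z) in
  block_mx A (- (A *m W z)) (- ((W z)^T *m A)) ((W z)^T *m A *m W z + B).

Lemma invmx_bundle_metric z : U (lsubmx z) ->
  invmx (bundle_metric z) = bundle_inverse z.
Proof.
move=> Uz; apply: invmx_unique; rewrite bundle_metricE /bundle_inverse.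
have gu := positive_definite_unitmx (g_pos Uz).
have hu := positive_definite_unitmx (h_pos Uz).
set A := expR _ *: invmx (gz z); set B := expR _ *: invmx (hz z).
have gA : (F1 z *: gz z) *m A = 1%:M.
  by rewrite -scalemxAl -scalemxAr scalerA mulmxV // mulrC expRN_mul scale1r.
have hB : (F2 z *: hz z) *m B = 1%:M.
  by rewrite -scalemxAl -scalemxAr scalerA mulmxV // mulrC expRN_mul scale1r.
have -> : F2 z *: (W z *m hz z) = W z *m (F2 z *: hz z) by rewrite scalemxAr.
have -> : F2 z *: (W z *m hz z *m (W z)^T) = W z *m (F2 z *: hz z) *m (W z)^T.
  by rewrite -scalemxAr -scalemxAl.
have -> : F2 z *: (hz z *m (W z)^T) = (F2 z *: hz z) *m (W z)^T.
  by rewrite -scalemxAl.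
move: (F1 z *: gz z) (F2 z *: hz z) gA hB => P Q PA QB.
rewrite mulmx_block scalar_mx_block; congr block_mx.
- by rewrite mulmxN mulmxDl PA !mulmxA addrK.
- rewrite mulmxN mulmxDl mulmxDr !mulmxA PA mul1mx -(mulmxA (W z) Q B) QB mulmx1.
  by rewrite opprD -addrA addKr addNr.
- by rewrite mulmxN !mulmxA subrr.
- by rewrite mulmxN mulmxDr !mulmxA QB addKr.
Qed.

Lemma christoffel_bundle_metric z a b c : U (lsubmx z) ->
  christoffel bundle_metric z a b c = 2^-1 * \sum_d bundle_inverse z c d *
    (bundle_metric' a z b d + bundle_metric' b z a d - bundle_metric' d z a b).
Proof.
move=> Uz; have E d i j : partial (fun y => bundle_metric y i j) d z =
    bundle_metric' d z i j.
  exact: (@derive_val _ _ _ _ _ _ _ (is_derive_bundle_metric d Uz i j)).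
rewrite /christoffel invmx_bundle_metric //; congr (_ * _).
by apply: eq_bigr => d _; rewrite !E.
Qed.

(** * Second derivatives at the zero section *)

Section ZeroSection.
Variable x : 'rV[R]_m.
Hypothesis Ux : U x.
Local Notation z0 := (row_mx x (0 : 'rV[R]_k)).

Lemma base_zero : lsubmx z0 = x. Proof. exact: row_mxKl. Qed.

Lemma base_zeroU : U (lsubmx z0). Proof. by rewrite base_zero. Qed.

Lemma fibre_sqnorm_zero : fibre_sqnorm z0 = 0.
Proof. by rewrite /fibre_sqnorm row_mxKr /bilin !mul0mx mxE. Qed.

Lemma fibre_sqnorm'_zero d : fibre_sqnorm' d z0 = 0.
Proof.
by rewrite /fibre_sqnorm' row_mxKr trmx0 mulmx0 !mul0mx addr0 mxE.
Qed.

Lemma shear_zero : W z0 = 0.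
Proof. by rewrite row_mxKr shear0l. Qed.

Lemma shear'_zero d : shear' d z0 = shear (rsubmx (e_ d)) (w x).
Proof. by rewrite /shear' row_mxKr shear0l addr0 base_zero. Qed.

Lemma is_derive_cfactor_zero phi a : smooth_halfline phi ->
  is_derive z0 (e_ (rshift m a)) (cfactor phi) 0.
Proof.
move=> phiS; apply: is_derive_peq (is_derive_cfactor _ phiS base_zeroU) _.
by rewrite fibre_sqnorm'_zero mulr0.
Qed.

Lemma is_derive_halfline_zero phi a : cvg (halfline_quotient phi 0) ->
  is_derive z0 (e_ (rshift m a)) (fun y => phi (fibre_sqnorm y)) 0.
Proof.
move=> phiP.
have phiP0 : cvg (halfline_quotient phi (fibre_sqnorm z0)).
  rewrite fibre_sqnorm_zero; exact: phiP.
apply: is_derive_peq (is_derive_halfline_fibre_sqnorm _ base_zeroU phiP0) _.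
by rewrite fibre_sqnorm'_zero mulr0.
Qed.

(** The second derivative of phi at 0 occurs multiplied by the derivative of r, which vanishes; its
    existence is [phiS 1]. *)
Lemma is_derive_cfactor'_zero phi a : smooth_halfline phi ->
  is_derive z0 (e_ (rshift m a)) (cfactor' phi) 0.
Proof.
move=> phiS; have d1 := is_derive_halfline_zero a (phiS 1%N 0 (lexx _)).
have := is_derive_pM (is_derive_cfactor_zero a phiS)
  (is_derive_pM (is_derive_pcst 2 z0 (e_ (rshift m a))) d1).
by rewrite !mul0r mulr0 !add0r mulr0.
Qed.

(** [s] is the second derivative of r along d and the a-th fibre direction, zero for horizontal d.
    [Wa] and [Wa'] are the derivatives along that fibre direction of W and of its d-derivative.
    Products with a factor W, v or r' left undifferentiated vanish at v = 0 and are absent. *)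
Definition bundle_metric'' (a : 'I_k) (d : 'I_(m + k)) : 'M[R]_(m + k) :=
  let s := (rsubmx (e_ d) *m h x *m (e_ a)^T
            + e_ a *m h x *m (rsubmx (e_ d))^T) 0 0 in
  let Wa := shear (e_ a) (w x) in
  let Wa' := shear (e_ a) (fun i => pullback_partial (w^~ i) d x) in
  let h'x := pullback_partial h d x in
  block_mx
    (F1' z0 * s *: g x + F2 z0 *: (W' d z0 *m h x *m Wa^T
                                   + Wa *m h x *m (W' d z0)^T))
    (F2 z0 *: (Wa' *m h x + Wa *m h'x))
    (F2 z0 *: (h'x *m Wa^T + h x *m Wa'^T))
    (F2' z0 * s *: h x).

Lemma is_derive_bundle_metric' a d :
  is_derive_mx (bundle_metric' d) z0 (e_ (rshift m a)) (bundle_metric'' a d).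
Proof.
have vd := is_derive_mx_rsubmx z0 (e_ (rshift m a)); rewrite rsubmx_basisr in vd.
have pull p q (f : 'rV[R]_m -> 'M[R]_(p, q)) :=
  is_derive_mx_pullback_vertical f z0 a.
have ed := is_derive_mx_cst (rsubmx (e_ d)) z0 (e_ (rshift m a)).
have Wd : is_derive_mx (fun y => W y) z0 (e_ (rshift m a)) (shear (e_ a) (w x)).
  have := is_derive_mx_shear vd (fun i => pull _ _ (w^~ i)).
  by rewrite shear0r addr0 base_zero.
have W'd : is_derive_mx (shear' d) z0 (e_ (rshift m a))
    (shear (e_ a) (fun i => pullback_partial (w^~ i) d x)).
  have := is_derive_mxD (is_derive_mx_shear ed (fun i => pull _ _ (w^~ i)))
     (is_derive_mx_shear vd (fun i => pull _ _ (pullback_partial (w^~ i) d))).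
  by rewrite !shear0r shear0l !addr0 add0r base_zero.
have r'd : is_derive z0 (e_ (rshift m a)) (fibre_sqnorm' d)
    ((rsubmx (e_ d) *m h x *m (e_ a)^T + e_ a *m h x *m (rsubmx (e_ d))^T) 0 0).
  have := is_derive_mxD
    (is_derive_mxM (is_derive_mxD (is_derive_mxM ed (pull _ _ h))
       (is_derive_mxM vd (pull _ _ (pullback_partial h d)))) (is_derive_mxT vd))
    (is_derive_mxM (is_derive_mxM vd (pull _ _ h)) (is_derive_mxT ed)) 0 0.
  move=> H; apply: is_derive_peq H _; congr (_ 0 0).
  by rewrite row_mxKr base_zero !(mulmx0, mul0mx, trmx0, addr0, add0r).
have F1d := is_derive_cfactor_zero a phi1_smooth.
have F2d := is_derive_cfactor_zero a phi2_smooth.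
have F1r := is_derive_pM (is_derive_cfactor'_zero a phi1_smooth) r'd.
have F2r := is_derive_pM (is_derive_cfactor'_zero a phi2_smooth) r'd.
have gd := pull _ _ g; have hd := pull _ _ h.
have g'd := pull _ _ (pullback_partial g d).
have h'd := pull _ _ (pullback_partial h d).
have WTd := is_derive_mxT Wd; have W'Td := is_derive_mxT W'd.
have := is_derive_mx_block
  (is_derive_mxD (is_derive_mxD (is_derive_mxZ F1r gd) (is_derive_mxZ F1d g'd))
    (is_derive_mxD
      (is_derive_mxZ F2r (is_derive_mxM (is_derive_mxM Wd hd) WTd))
      (is_derive_mxZ F2d (is_derive_mxD
         (is_derive_mxM (is_derive_mxD (is_derive_mxM W'd hd)
                                       (is_derive_mxM Wd h'd)) WTd)
         (is_derive_mxM (is_derive_mxM Wd hd) W'Td)))))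
  (is_derive_mxD (is_derive_mxZ F2r (is_derive_mxM Wd hd))
     (is_derive_mxZ F2d (is_derive_mxD (is_derive_mxM W'd hd)
                                       (is_derive_mxM Wd h'd))))
  (is_derive_mxD (is_derive_mxZ F2r (is_derive_mxM hd WTd))
     (is_derive_mxZ F2d (is_derive_mxD (is_derive_mxM h'd WTd)
                                       (is_derive_mxM hd W'Td))))
  (is_derive_mxD (is_derive_mxZ F2r hd) (is_derive_mxZ F2d h'd)).
move=> H; apply: is_derive_mx_eq H _.
rewrite shear_zero fibre_sqnorm'_zero base_zero /bundle_metric''.
by rewrite !(mulmx0, mul0mx, trmx0, addr0, add0r, mul0r, mulr0, scaler0, scale0r).
Qed.

Lemma is_derive_bundle_inverse a (Wa := shear (e_ a) (w x))
    (A := expR (- (2 * phi1 0)) *: invmx (g x)) :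
  is_derive_mx bundle_inverse z0 (e_ (rshift m a))
    (block_mx 0 (- (A *m Wa)) (- (Wa^T *m A)) 0).
Proof.
have vd := is_derive_mx_rsubmx z0 (e_ (rshift m a)); rewrite rsubmx_basisr in vd.
have pull p q (f : 'rV[R]_m -> 'M[R]_(p, q)) :=
  is_derive_mx_pullback_vertical f z0 a.
have Wd : is_derive_mx (fun y => W y) z0 (e_ (rshift m a)) Wa.
  have := is_derive_mx_shear vd (fun i => pull _ _ (w^~ i)).
  by rewrite shear0r addr0 base_zero.
have Fd phi : smooth_halfline phi -> is_derive z0 (e_ (rshift m a))
    (fun y => expR (- (2 * phi (fibre_sqnorm y)))) 0.
  move=> phiS; have pd := is_derive_halfline_zero a (phiS 0%N 0 (lexx _)).
  have := is_derive_comp1 (is_derive_expR _) (is_derive_pN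
    (is_derive_pM (is_derive_pcst 2 z0 (e_ (rshift m a))) pd)).
  by rewrite mul0r mulr0 addr0 oppr0 mulr0.
have Ad := is_derive_mxZ (Fd _ phi1_smooth) (pull _ _ (fun x => invmx (g x))).
have Bd := is_derive_mxZ (Fd _ phi2_smooth) (pull _ _ (fun x => invmx (h x))).
have := is_derive_mx_block Ad (is_derive_mxN (is_derive_mxM Ad Wd))
  (is_derive_mxN (is_derive_mxM (is_derive_mxT Wd) Ad))
  (is_derive_mxD (is_derive_mxM (is_derive_mxM (is_derive_mxT Wd) Ad) Wd) Bd).
move=> H; apply: is_derive_mx_eq H _.
rewrite shear_zero base_zero fibre_sqnorm_zero.
by rewrite !(mulmx0, mul0mx, trmx0, addr0, add0r, scaler0, scale0r).
Qed.

Lemma bundle_inverse_zero : bundle_inverse z0 =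
  block_mx (expR (- (2 * phi1 0)) *: invmx (g x)) 0
           0 (expR (- (2 * phi2 0)) *: invmx (h x)).
Proof.
rewrite /bundle_inverse shear_zero base_zero fibre_sqnorm_zero.
by rewrite !(mulmx0, mul0mx, trmx0, addr0, add0r, oppr0).
Qed.

Lemma bundle_metric'_zerol l : bundle_metric' (lshift k l) z0 =
  block_mx (expR (2 * phi1 0) *: partial g l x) 0
           0 (expR (2 * phi2 0) *: partial h l x).
Proof.
rewrite /bundle_metric' shear'_zero rsubmx_basisl shear_zero fibre_sqnorm'_zero.
rewrite base_zero !pullback_partiall shear0l /cfactor fibre_sqnorm_zero.
by rewrite !(mulmx0, mul0mx, trmx0, addr0, add0r, mulr0, scaler0, scale0r).
Qed.

Lemma bundle_metric'_zeror a : bundle_metric' (rshift m a) z0 =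
  block_mx 0 (expR (2 * phi2 0) *: (shear (e_ a) (w x) *m h x))
           (expR (2 * phi2 0) *: (h x *m (shear (e_ a) (w x))^T)) 0.
Proof.
rewrite /bundle_metric' shear'_zero rsubmx_basisr shear_zero fibre_sqnorm'_zero.
rewrite base_zero !pullback_partialr /cfactor fibre_sqnorm_zero.
by rewrite !(mulmx0, mul0mx, trmx0, addr0, add0r, mulr0, scaler0, scale0r).
Qed.

(** [K] is the Koszul bracket. The formula of [christoffel_bundle_metric] holds in a neighbourhood
    of the zero section, so the product rule applies to it. *)
Lemma is_derive_christoffel_vertical e a b c :
  let K (D : 'I_(m + k) -> 'M[R]_(m + k)) d := D a b d + D b a d - D d a b in
  is_derive z0 (e_ (rshift m e)) (fun y => christoffel bundle_metric y a b c)
    (2^-1 * \sum_d (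
      block_mx 0 (- ((expR (- (2 * phi1 0)) *: invmx (g x)) *m shear (e_ e) (w x)))
        (- ((shear (e_ e) (w x))^T *m (expR (- (2 * phi1 0)) *: invmx (g x)))) 0 c d
        * K (fun d => bundle_metric' d z0) d
      + bundle_inverse z0 c d * K (bundle_metric'' e) d)).
Proof.
move=> K.
have E : \forall y \near z0, 2^-1 * \sum_d bundle_inverse y c d *
    (bundle_metric' a y b d + bundle_metric' b y a d - bundle_metric' d y a b) =
    christoffel bundle_metric y a b c.
  by apply: filterS (near_base base_zeroU) => y Uy; rewrite christoffel_bundle_metric.
apply: near_eq_is_derive E _.
have md d i j : is_derive z0 (e_ (rshift m e)) (fun y => bundle_metric' d y i j)
  (bundle_metric'' e d i j) by exact: is_derive_bundle_metric'.
have := is_derive_pM (is_derive_pcst 2^-1 z0 (e_ (rshift m e)))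
  (is_derive_psum (fun d => is_derive_pM (is_derive_bundle_inverse e c d)
    (is_derive_pD (is_derive_pD (md a b d) (md b a d)) (is_derive_pN (md d a b))))).
by rewrite mul0r add0r.
Qed.
Lemma cfactor_zero phi : cfactor phi z0 = expR (2 * phi 0).
Proof. by rewrite /cfactor fibre_sqnorm_zero. Qed.

Lemma bundle_metric_zero : bundle_metric z0 =
  block_mx (expR (2 * phi1 0) *: g x) 0 0 (expR (2 * phi2 0) *: h x).
Proof.
rewrite bundle_metricE shear_zero base_zero !cfactor_zero.
by rewrite !(mulmx0, mul0mx, trmx0, addr0, scaler0).
Qed.

Lemma cfactor'_zero phi :
  cfactor' phi z0 = expR (2 * phi 0) * (2 * halfline_derive phi 0).
Proof. by rewrite /cfactor' cfactor_zero fibre_sqnorm_zero. Qed.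

End ZeroSection.

Lemma shear_basis_mul (c : 'I_m -> 'M[R]_k) p (H : 'M[R]_(k, p)) a i b :
  (shear (e_ a) c *m H) i b = (c i *m H) a b.
Proof. by rewrite !mxE; apply: eq_bigr => d _; rewrite shear_basis. Qed.

Lemma mul_shear_basisT (c : 'I_m -> 'M[R]_k) p (H : 'M[R]_(p, k)) a i b :
  (H *m (shear (e_ a) c)^T) b i = (H *m (c i)^T) b a.
Proof. by rewrite !mxE; apply: eq_bigr => d _; rewrite mxE shear_basis mxE. Qed.

Lemma sum_mulmx_trmx p q (A B : 'M[R]_(p, q)) :
  \sum_i \sum_j A i j * B i j = \tr (A *m B^T).
Proof.
by apply: eq_bigr => i _; rewrite mxE; apply: eq_bigr => j _; rewrite mxE.
Qed.

(** This is D g_E = 0 on the coordinate frame of E, obtained for the actual bundle in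
    [partial_fibre_metric]. *)
Hypothesis compat : forall x i, U x ->
  partial h i x = w x i *m h x + h x *m (w x i)^T.

(** * Christoffel symbols at the zero section *)

Section Values.
Variable x : 'rV[R]_m.
Hypothesis Ux : U x.
Local Notation z0 := (row_mx x (0 : 'rV[R]_k)).
Local Notation C1 := (expR (2 * phi1 0)).
Local Notation C2 := (expR (2 * phi2 0)).
Local Notation l_ i := (lshift k i).
Local Notation r_ i := (rshift m i).
Local Notation Gam a b c := (christoffel bundle_metric z0 a b c).

Lemma h_sym : (h x)^T = h x. Proof. by case: (h_pos Ux). Qed.

Lemma h_symE a b : h x a b = h x b a. Proof. by rewrite -{1}h_sym mxE. Qed.

Lemma h_unit : h x \in unitmx. Proof. exact: positive_definite_unitmx (h_pos Ux). Qed.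

Lemma hwT i a b : (h x *m (w x i)^T) a b = (w x i *m h x) b a.
Proof. by rewrite -[in LHS]h_sym -trmx_mul mxE. Qed.

Lemma partial_hE i a b : partial h i x a b = (w x i *m h x) a b + (w x i *m h x) b a.
Proof. by rewrite compat // mxE hwT. Qed.

(** In the suffixes l is a base and r a fibre index. For [bundle_metric'] the first letter is the
    direction of differentiation, for [christoffel] the last one is the upper index. *)
Lemma bundle_metric'_lll a i j : bundle_metric' (l_ a) z0 (l_ i) (l_ j) =
  C1 * partial (fun y => g y i j) a x.
Proof. by rewrite bundle_metric'_zerol block_mxEul mxE (partial_entry _ _ _ gU Ux). Qed.

Lemma bundle_metric'_llr a i j : bundle_metric' (l_ a) z0 (l_ i) (r_ j) = 0.
Proof. by rewrite bundle_metric'_zerol block_mxEur mxE. Qed.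

Lemma bundle_metric'_lrl a i j : bundle_metric' (l_ a) z0 (r_ i) (l_ j) = 0.
Proof. by rewrite bundle_metric'_zerol block_mxEdl mxE. Qed.

Lemma bundle_metric'_lrr a i j : bundle_metric' (l_ a) z0 (r_ i) (r_ j) =
  C2 * ((w x a *m h x) i j + (w x a *m h x) j i).
Proof. by rewrite bundle_metric'_zerol block_mxEdr mxE partial_hE. Qed.

Lemma bundle_metric'_rll a i j : bundle_metric' (r_ a) z0 (l_ i) (l_ j) = 0.
Proof. by rewrite bundle_metric'_zeror block_mxEul mxE. Qed.

Lemma bundle_metric'_rlr a i j : bundle_metric' (r_ a) z0 (l_ i) (r_ j) =
  C2 * (w x i *m h x) a j.
Proof. by rewrite bundle_metric'_zeror block_mxEur mxE shear_basis_mul. Qed.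

Lemma bundle_metric'_rrl a i j : bundle_metric' (r_ a) z0 (r_ i) (l_ j) =
  C2 * (w x j *m h x) a i.
Proof. by rewrite bundle_metric'_zeror block_mxEdl mxE mul_shear_basisT hwT. Qed.

Lemma bundle_metric'_rrr a i j : bundle_metric' (r_ a) z0 (r_ i) (r_ j) = 0.
Proof. by rewrite bundle_metric'_zeror block_mxEdr mxE. Qed.

Local Notation koszul a b d := (bundle_metric' a z0 b d + bundle_metric' b z0 a d
  - bundle_metric' d z0 a b).

Lemma christoffel_zerol a b c : Gam a b (l_ c) = 2^-1 *
  \sum_(d < m) (expR (- (2 * phi1 0)) *: invmx (g x)) c d * koszul a b (l_ d).
Proof.
rewrite christoffel_bundle_metric ?base_zero // bundle_inverse_zero.
rewrite big_split_ord /= [X in _ + X]big1 ?addr0 => [|d _].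
  by under eq_bigr do rewrite block_mxEul.
by rewrite block_mxEur mxE mul0r.
Qed.

Lemma christoffel_zeror a b c : Gam a b (r_ c) = 2^-1 *
  \sum_(d < k) (expR (- (2 * phi2 0)) *: invmx (h x)) c d * koszul a b (r_ d).
Proof.
rewrite christoffel_bundle_metric ?base_zero // bundle_inverse_zero.
rewrite big_split_ord /= [X in X + _]big1 ?add0r => [|d _].
  by under eq_bigr do rewrite block_mxEdr.
by rewrite block_mxEdl mxE mul0r.
Qed.

Lemma christoffel_lll i j c : Gam (l_ i) (l_ j) (l_ c) = christoffel g x i j c.
Proof.
rewrite christoffel_zerol; congr (_ * _); apply: eq_bigr => d _.
rewrite (bundle_metric'_lll i j d) (bundle_metric'_lll j i d).
by rewrite (bundle_metric'_lll d i j) mxE -mulrDr -mulrBr mulrACA expRN_mul mul1r.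
Qed.

(** The zero section is totally geodesic. *)
Lemma christoffel_llr i j c : Gam (l_ i) (l_ j) (r_ c) = 0.
Proof.
rewrite christoffel_zeror big1 ?mulr0 // => d _.
rewrite (bundle_metric'_llr i j d) (bundle_metric'_llr j i d).
by rewrite (bundle_metric'_rll d i j) subr0 addr0 mulr0.
Qed.

Lemma christoffel_lrl i b c : Gam (l_ i) (r_ b) (l_ c) = 0.
Proof.
rewrite christoffel_zerol big1 ?mulr0 // => d _.
rewrite (bundle_metric'_lrl i b d) (bundle_metric'_rll b i d).
by rewrite (bundle_metric'_llr d i b) subr0 addr0 mulr0.
Qed.

Lemma christoffel_rll i b c : Gam (r_ b) (l_ i) (l_ c) = 0.
Proof.
rewrite christoffel_zerol big1 ?mulr0 // => d _.
rewrite (bundle_metric'_rll b i d) (bundle_metric'_lrl i b d).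
by rewrite (bundle_metric'_lrl d b i) subr0 addr0 mulr0.
Qed.

Lemma sum_invmx_h (c : 'I_k) (K : 'I_k -> R) (M : 'M[R]_k) b :
  (forall d, K d = 2 * (C2 * (M *m h x) b d)) ->
  2^-1 * \sum_d (expR (- (2 * phi2 0)) *: invmx (h x)) c d * K d = M b c.
Proof.
move=> KE.
have E d : (expR (- (2 * phi2 0)) *: invmx (h x)) c d * K d =
    2 * ((M *m h x) b d * invmx (h x) d c).
  have hV : (expR (- (2 * phi2 0)) *: invmx (h x)) c d =
      expR (- (2 * phi2 0)) * invmx (h x) d c.
    by rewrite mxE -{1}h_sym -trmx_inv mxE.
  rewrite KE hV.
  transitivity (expR (- (2 * phi2 0)) * C2 *
    (2 * ((M *m h x) b d * invmx (h x) d c))); first ring.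
  by rewrite expRN_mul mul1r.
under eq_bigr do rewrite E.
rewrite -mulr_sumr mulrA mulVf ?mul1r ?pnatr_eq0 //.
by rewrite -[in RHS](mulmxK h_unit M) [RHS]mxE.
Qed.

(** On the normal bundle of the zero section, which is E, the Levi-Civita connection induces D^E:
    the skew contributions of the shear complete the symmetric derivative of h to twice w_i h. *)
Lemma christoffel_lrr i b c : Gam (l_ i) (r_ b) (r_ c) = w x i b c.
Proof.
rewrite christoffel_zeror; apply: sum_invmx_h => d.
rewrite (bundle_metric'_lrr i b d) (bundle_metric'_rlr b i d).
rewrite (bundle_metric'_rlr d i b); ring.
Qed.

Lemma christoffel_rlr i b c : Gam (r_ b) (l_ i) (r_ c) = w x i b c.
Proof.
rewrite christoffel_zeror; apply: sum_invmx_h => d.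
rewrite (bundle_metric'_rlr b i d) (bundle_metric'_lrr i b d).
rewrite (bundle_metric'_rrl d b i); ring.
Qed.

(** By compatibility the base derivative of h is exactly the sum of the two shear derivatives; the
    fibres have no second fundamental form at v = 0. *)
Lemma koszul_rrl a b (d : 'I_m) : koszul (r_ a) (r_ b) (l_ d) = 0.
Proof.
rewrite (bundle_metric'_rrl a b d) (bundle_metric'_rrl b a d).
rewrite (bundle_metric'_lrr d a b); ring.
Qed.

Lemma koszul_rrr a b d : koszul (r_ a) (r_ b) (r_ d) = 0.
Proof.
rewrite (bundle_metric'_rrr a b d) (bundle_metric'_rrr b a d).
by rewrite (bundle_metric'_rrr d a b) subr0 addr0.
Qed.

Lemma christoffel_rr a b c : Gam (r_ a) (r_ b) c = 0.
Proof.
case: (split_ordP c) => c' ->.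
  by rewrite christoffel_zerol big1 ?mulr0 // => d _; rewrite koszul_rrl mulr0.
by rewrite christoffel_zeror big1 ?mulr0 // => d _; rewrite koszul_rrr mulr0.
Qed.

(** * Vertical derivatives of the Christoffel symbols *)

Local Notation koszul'' e a b d := (bundle_metric'' x e a b d
  + bundle_metric'' x e b a d - bundle_metric'' x e d a b).

Lemma bundle_metric''_llr e i j d : bundle_metric'' x e (l_ i) (l_ j) (r_ d) =
  C2 * (partial (w^~ j) i x *m h x + w x j *m partial h i x) e d.
Proof.
rewrite block_mxEur [LHS]mxE [X in _ * X]mxE !shear_basis_mul cfactor_zero.
by rewrite !pullback_partiall [in RHS]mxE.
Qed.

Lemma polarisation_basis e d :
  (e_ d *m h x *m (e_ e)^T + e_ e *m h x *m (e_ d)^T) 0 0 = 2 * h x e d.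
Proof.
rewrite mxE -!/(bilin _ _ _) !bilin_basis h_symE; ring.
Qed.

Lemma bundle_metric''_rll e d i j : bundle_metric'' x e (r_ d) (l_ i) (l_ j) =
  C1 * (2 * halfline_derive phi1 0) * (2 * h x e d) * g x i j
  + C2 * ((w x i *m h x *m (w x j)^T) d e + (w x i *m h x *m (w x j)^T) e d).
Proof.
rewrite block_mxEul [LHS]mxE; congr (_ + _).
  by rewrite [LHS]mxE cfactor'_zero rsubmx_basisr polarisation_basis.
rewrite [LHS]mxE [X in _ * X]mxE cfactor_zero shear'_zero // rsubmx_basisr.
by rewrite !mul_shear_basisT -!mulmxA !shear_basis_mul.
Qed.

Lemma bundle_metric''_rrr e a i j : bundle_metric'' x e (r_ a) (r_ i) (r_ j) =
  C2 * (2 * halfline_derive phi2 0) * (2 * h x a e) * h x i j.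
Proof.
rewrite block_mxEdr [LHS]mxE cfactor'_zero rsubmx_basisr polarisation_basis.
by rewrite h_symE.
Qed.

Lemma bundle_inverse_rl a b : bundle_inverse z0 (r_ a) (l_ b) = 0.
Proof. by rewrite bundle_inverse_zero block_mxEdl mxE. Qed.

Lemma bundle_inverse_rr a b : bundle_inverse z0 (r_ a) (r_ b) =
  (expR (- (2 * phi2 0)) *: invmx (h x)) a b.
Proof. by rewrite bundle_inverse_zero block_mxEdr. Qed.

(** The first sum comes from the off-diagonal block of the differentiated inverse, contracted with
    the bracket of g; the second from the differentiated bracket. *)
Lemma derive_christoffel_llr e i j :
  'D_(e_ (r_ e)) (fun y => christoffel bundle_metric y (l_ i) (l_ j) (r_ e)) z0 =
  - (\sum_l w x l e e * christoffel g x i j l) +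
  2^-1 * \sum_d (expR (- (2 * phi2 0)) *: invmx (h x)) e d *
    koszul'' e (l_ i) (l_ j) (r_ d).
Proof.
rewrite (@derive_val _ _ _ _ _ _ _
  (is_derive_christoffel_vertical Ux e (l_ i) (l_ j) (r_ e))).
rewrite big_split_ord /= mulrDr; congr (_ + _); last first.
  congr (_ * _); apply: eq_bigr => d _.
  by rewrite bundle_inverse_rr block_mxEdr [X in X * _]mxE mul0r add0r.
set A := expR _ *: invmx (g x).
have dE d : block_mx 0 (- (A *m shear (e_ e) (w x)))
    (- ((shear (e_ e) (w x))^T *m A)) 0 (r_ e) (l_ d) =
    - \sum_p w x p e e * A p d.
  rewrite block_mxEdl mxE mxE; congr (- _); apply: eq_bigr => p _.
  by rewrite mxE shear_basis.
under eq_bigr => d _ do rewrite bundle_inverse_rl mul0r addr0 dE mulNr big_distrl /=.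
rewrite sumrN mulrN exchange_big /= mulr_sumr; congr (- _).
apply: eq_bigr => l _; rewrite -christoffel_lll christoffel_zerol mulrCA.
congr (_ * _); rewrite mulr_sumr; apply: eq_bigr => d _.
by rewrite mulrA.
Qed.

Lemma h_inv_sym : (invmx (h x))^T = invmx (h x).
Proof. by rewrite trmx_inv h_sym. Qed.

Lemma sum_invmx_h_trace (X : 'M[R]_k) :
  \sum_e \sum_d (expR (- (2 * phi2 0)) *: invmx (h x)) e d * X e d =
  expR (- (2 * phi2 0)) * \tr (X *m invmx (h x)).
Proof.
rewrite sum_mulmx_trmx -scalemxAl mxtraceZ; congr (_ * _).
by rewrite -mxtrace_tr trmx_mul trmxK h_inv_sym.
Qed.

Lemma mxtrace_conjugate (X : 'M[R]_k) : \tr (h x *m X *m invmx (h x)) = \tr X.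
Proof. by rewrite mxtrace_mulC mulmxA mulVmx ?mul1mx ?h_unit. Qed.

Lemma mxtrace_dual (X : 'M[R]_k) : \tr (h x *m X^T *m invmx (h x)) = \tr X.
Proof. by rewrite mxtrace_conjugate mxtrace_tr. Qed.

(* The trace of the curvature of the connection vanishes: this is the symmetry
   of the second derivatives of h, traced with the inverse of h. *)
Lemma mxtrace_partial_sym i j :
  \tr (partial (w^~ j) i x) = \tr (partial (w^~ i) j x).
Proof.
have second a b : partial (partial h a) b x =
    partial (w^~ a) b x *m h x + w x a *m (w x b *m h x + h x *m (w x b)^T)
    + ((w x b *m h x + h x *m (w x b)^T) *m (w x a)^T
       + h x *m (partial (w^~ a) b x)^T).
  have wd := is_derive_mx_smooth b (wU a) Ux.
  have hd := is_derive_mx_smooth b hU Ux; rewrite (compat b Ux) in hd.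
  have H := is_derive_mxD (is_derive_mxM wd hd) (is_derive_mxM hd (is_derive_mxT wd)).
  have E : \forall y \near x, w y a *m h y + h y *m (w y a)^T = partial h a y.
    by apply: filterS (open_nbhs_nbhs (conj oU Ux)) => y Uy; rewrite compat.
  exact: (@derive_val _ _ _ _ _ _ _ (is_derive_mx_derive (is_derive_mx_near E H))).
have sym : partial (partial h j) i x = partial (partial h i) j x.
  apply/matrixP => a b.
  have E c d : partial (partial h c) d x a b =
      partial (partial (fun y => h y a b) c) d x.
    rewrite -(partial_entry a b d (smooth_on_partial c hU) Ux).
    apply: near_eq_derive; apply: filterS (open_nbhs_nbhs (conj oU Ux)) => y Uy.
    by rewrite (partial_entry a b c hU Uy).
  have S := @smooth_on_schwarz R m U (fun y => h y a b) x j i oU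
    (smooth_on_entry a b oU hU) Ux.
  exact: (etrans (E j i) (etrans S (esym (E i j)))).
have /(congr1 (fun M => \tr (M *m invmx (h x)))) :=
  etrans (esym (second j i)) (etrans sym (second i j)).
move: (partial (w^~ j) i x) (partial (w^~ i) j x) (w x i) (w x j) => Q' P' P Q.
(* Apart from 2 tr X' the right-hand side is symmetric in X and Y, so equating the two orders of
   differentiation leaves only the traces of the derivatives of w. *)
have tr_second (X' X Y : 'M[R]_k) :
    \tr ((X' *m h x + X *m (Y *m h x + h x *m Y^T)
      + ((Y *m h x + h x *m Y^T) *m X^T + h x *m X'^T)) *m invmx (h x)) =
    2 * \tr X' + 2 * \tr (X *m Y) + (\tr (X *m h x *m Y^T *m invmx (h x))
      + \tr (Y *m h x *m X^T *m invmx (h x))).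
  rewrite !mulmxDr !mulmxDl !mulmxA !(mulmxK h_unit) !mxtraceD.
  rewrite mxtrace_dual -(mulmxA (h x)) -trmx_mul mxtrace_dual; ring.
rewrite !tr_second mxtrace_mulC.
move: (\tr (P *m Q)) (\tr (Q *m _ *m _ *m _)) (\tr (P *m _ *m _ *m _)) => s t u H.
lra.
Qed.

Lemma mxtrace_h : \tr (h x *m invmx (h x)) = k%:R.
Proof. by rewrite mulmxV ?h_unit // mxtrace1. Qed.

Lemma sum_derive_christoffel_llr i j :
  \sum_e 'D_(e_ (r_ e)) (fun y => christoffel bundle_metric y (l_ i) (l_ j) (r_ e)) z0 =
  - (\sum_l \tr (w x l) * christoffel g x i j l)
  + 2^-1 * (\tr (partial (w^~ j) i x) + \tr (partial (w^~ i) j x)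
            + 2 * \tr (w x i *m w x j))
  - k%:R * (C1 * expR (- (2 * phi2 0)) * (2 * halfline_derive phi1 0)) * g x i j.
Proof.
under eq_bigr do rewrite derive_christoffel_llr.
rewrite big_split /= sumrN exchange_big /= -addrA; congr (- _ + _).
  by apply: eq_bigr => l _; rewrite -mulr_suml.
pose N := w x i *m h x *m (w x j)^T.
have entry (X1 X2 M : 'M[R]_k) a b :
    (X1 + X2 - M^T - M) a b = X1 a b + X2 a b - M b a - M a b by rewrite !mxE.
(* [X1] and [X2] are the base derivatives of the mixed block W h, [N] and its transpose come from W
   h W^T in the horizontal block; the rest of the bracket is the conformal term in phi1'(0). *)
pose X1 := partial (w^~ j) i x *m h x + w x j *m partial h i x.
pose X2 := partial (w^~ i) j x *m h x + w x i *m partial h j x.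
pose Y := X1 + X2 - N^T - N.
have E e d : koszul'' e (l_ i) (l_ j) (r_ d) =
    C2 * Y e d - 2 * (C1 * (2 * halfline_derive phi1 0) * g x i j) * h x e d.
  have K1 : bundle_metric'' x e (l_ i) (l_ j) (r_ d) = C2 * X1 e d.
    exact: bundle_metric''_llr.
  have K2 : bundle_metric'' x e (l_ j) (l_ i) (r_ d) = C2 * X2 e d.
    exact: bundle_metric''_llr.
  have K3 : bundle_metric'' x e (r_ d) (l_ i) (l_ j) =
      C1 * (2 * halfline_derive phi1 0) * (2 * h x e d) * g x i j
      + C2 * (N d e + N e d) by exact: bundle_metric''_rll.
  have EY : Y e d = X1 e d + X2 e d - N d e - N e d by exact: entry.
  apply: etrans (congr2 (fun s t : R => s - t)
    (congr2 (fun s t : R => s + t) K1 K2) K3) _.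
  rewrite EY; clearbody X1 X2 Y N; ring.
under eq_bigr => e _ do under eq_bigr => d _ do
  rewrite E mulrBr mulrCA [X in _ - X]mulrCA.
under eq_bigr => e _ do rewrite sumrB -!mulr_sumr.
rewrite -mulr_sumr sumrB -!mulr_sumr !sum_invmx_h_trace mxtrace_h.
(* Expanding the derivatives of h by compatibility produces w_j h w_i^T and w_i h w_j^T, which
   cancel N^T and N. *)
have -> : \tr (Y *m invmx (h x)) = \tr (partial (w^~ j) i x)
    + \tr (partial (w^~ i) j x) + 2 * \tr (w x i *m w x j).
  rewrite /Y /X1 /X2 /N !compat //.
  move: (partial (w^~ j) i x) (partial (w^~ i) j x) (w x i) (w x j) => Q' P' P Q.
  rewrite !trmx_mul trmxK h_sym !mulmxDr !mulmxBl !mulmxDl !mulmxA.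
  have trB (X Z : 'M[R]_k) : \tr (X - Z) = \tr X - \tr Z by exact: raddfB.
  rewrite !(mulmxK h_unit) !trB !mxtraceD (mxtrace_mulC Q P); ring.
move: (\tr (partial (w^~ j) i x)) (\tr (partial (w^~ i) j x))
  (\tr (w x i *m w x j)) => s t u.
have E2 := expRN_mul (2 * phi2 0).
have -> : C2 * (expR (- (2 * phi2 0)) * (s + t + 2 * u)) = s + t + 2 * u.
  by rewrite mulrA [C2 * _]mulrC expRN_mul mul1r.
by field.
Qed.
Lemma derive_christoffel_rrr e a :
  'D_(e_ (r_ e)) (fun y => christoffel bundle_metric y (r_ a) (r_ a) (r_ e)) z0 =
  2^-1 * \sum_d (expR (- (2 * phi2 0)) *: invmx (h x)) e d *
    koszul'' e (r_ a) (r_ a) (r_ d).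
Proof.
rewrite (@derive_val _ _ _ _ _ _ _
  (is_derive_christoffel_vertical Ux e (r_ a) (r_ a) (r_ e))).
rewrite big_split_ord /= [X in _ * (X + _)]big1 ?add0r => [|d _].
  congr (_ * _); apply: eq_bigr => d _.
  by rewrite koszul_rrr mulr0 add0r bundle_inverse_rr.
by rewrite koszul_rrl mulr0 add0r bundle_inverse_rl mul0r.
Qed.

Lemma sum_derive_christoffel_rrr a :
  \sum_e 'D_(e_ (r_ e)) (fun y => christoffel bundle_metric y (r_ a) (r_ a) (r_ e)) z0 =
  (2 * halfline_derive phi2 0) * (2 - k%:R) * h x a a.
Proof.
under eq_bigr do rewrite derive_christoffel_rrr.
set b := 2 * halfline_derive phi2 0.
(* The rank one matrix h_ea h_ad has trace h_aa against the inverse of h: it yields the 2 in 2 - k,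
   while the trace of h against its inverse yields k. *)
pose X1 := col a (h x) *m row a (h x).
have E e d : koszul'' e (r_ a) (r_ a) (r_ d) =
    (2 * C2 * b) * (2 * X1 e d - h x a a * h x e d).
  have K1 : bundle_metric'' x e (r_ a) (r_ a) (r_ d) =
      C2 * b * (2 * h x a e) * h x a d by exact: bundle_metric''_rrr.
  have K2 : bundle_metric'' x e (r_ d) (r_ a) (r_ a) =
      C2 * b * (2 * h x d e) * h x a a by exact: bundle_metric''_rrr.
  apply: etrans (congr2 (fun s t : R => s - t)
    (congr2 (fun s t : R => s + t) K1 K1) K2) _.
  have -> : X1 e d = h x a e * h x a d.
    by rewrite mxE big_ord1 !mxE (h_symE e a).
  rewrite (h_symE d e); ring.
have E' (c : R) e d : c * koszul'' e (r_ a) (r_ a) (r_ d) =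
    (2 * C2 * b) * (2 * (c * X1 e d) - h x a a * (c * h x e d)).
  by rewrite E; ring.
under eq_bigr => e _ do under eq_bigr => d _ do rewrite E'.
under eq_bigr => e _ do rewrite -mulr_sumr sumrB -!mulr_sumr.
rewrite -!mulr_sumr sumrB -!mulr_sumr !sum_invmx_h_trace mxtrace_h.
have -> : \tr (X1 *m invmx (h x)) = h x a a.
  rewrite /X1 -mulmxA mxtrace_mulC -row_mul mulmxV ?h_unit //.
  by rewrite -row_mul mul1mx /mxtrace big_ord1 !mxE.
transitivity (expR (- (2 * phi2 0)) * C2 * (b * (2 - k%:R) * h x a a)).
  by field.
by rewrite expRN_mul mul1r.
Qed.

(** Stated off the zero section too, since it is differentiated vertically in
    [derive_christoffel_trace]. *)
Lemma sum_christoffel_r y a : U (lsubmx y) ->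
  \sum_c christoffel bundle_metric y c (r_ a) c =
  2^-1 * \sum_c \sum_d bundle_inverse y c d * bundle_metric' (r_ a) y c d.
Proof.
move=> Uy.
have sym z : U (lsubmx z) -> (bundle_metric z)^T = bundle_metric z.
  move=> Uz; have [gT _] := g_pos Uz; have [hT _] := h_pos Uz.
  rewrite bundle_metricE tr_block_mx !linearD !linearZ /= !trmx_mul gT hT trmxK.
  by rewrite mulmxA.
have E d i j : partial (fun z => bundle_metric z i j) d y = bundle_metric' d y i j.
  exact: (@derive_val _ _ _ _ _ _ _ (is_derive_bundle_metric d Uy i j)).
rewrite christoffel_trace ?sym // => [|b c d].
  rewrite invmx_bundle_metric //; congr (_ * _).
  by apply: eq_bigr => c _; apply: eq_bigr => d _; rewrite E.
apply: near_eq_derive; apply: filterS (near_base Uy) => z Uz.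
by rewrite -{1}(sym z Uz) mxE.
Qed.

Lemma derive_christoffel_trace a :
  'D_(e_ (r_ a)) (fun y => \sum_c christoffel bundle_metric y c (r_ a) c) z0 =
  (m%:R * (2 * halfline_derive phi1 0) + k%:R * (2 * halfline_derive phi2 0))
    * h x a a.
Proof.
have nE : \forall y \near z0, 2^-1 * \sum_c \sum_d
    bundle_inverse y c d * bundle_metric' (r_ a) y c d =
    \sum_c christoffel bundle_metric y c (r_ a) c.
  apply: filterS (near_base (base_zeroU Ux)) => y Uy.
  by rewrite sum_christoffel_r.
have H := is_derive_pM (is_derive_pcst 2^-1 z0 (e_ (r_ a)))
  (is_derive_psum (fun c => is_derive_psum (fun d =>
    is_derive_pM (is_derive_bundle_inverse Ux a c d)
                 (is_derive_bundle_metric' Ux a (r_ a) c d)))).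
rewrite (@derive_val _ _ _ _ _ _ _ (near_eq_is_derive nE H)) mul0r add0r.
under eq_bigr => c _ do rewrite big_split.
rewrite big_split /= !sum_mulmx_trmx.
rewrite bundle_inverse_zero bundle_metric'_zeror /bundle_metric''.
rewrite cfactor_zero !cfactor'_zero shear'_zero // rsubmx_basisr polarisation_basis.
rewrite !pullback_partialr.
have hT := h_sym; have [gT _] := g_pos Ux.
have gu := positive_definite_unitmx (g_pos Ux).
set A := expR _ *: invmx (g x); set Wa := shear _ _.
set B := expR _ *: invmx (h x).
have gA : \tr (A *m g x) = expR (- (2 * phi1 0)) * m%:R.
  by rewrite -scalemxAl mulVmx // mxtraceZ mxtrace1.
have hB : \tr (B *m h x) = expR (- (2 * phi2 0)) * k%:R.
  by rewrite -scalemxAl mulVmx ?h_unit // mxtraceZ mxtrace1.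
clearbody A B Wa.
rewrite !tr_block_mx !mulmx_block !mxtrace_block.
rewrite !(trmx0, mulmx0, mul0mx, addr0, add0r) !linearD !linearZ /=.
rewrite !trmx_mul !trmxK gT hT !mulNmx gA hB.
have -> : \tr (- (A *m Wa *m (h x *m Wa^T))) = - \tr (A *m (Wa *m (h x *m Wa^T))).
  by rewrite raddfN /= !mulmxA.
have -> : \tr (- (Wa^T *m A *m (Wa *m h x))) = - \tr (A *m (Wa *m (h x *m Wa^T))).
  by rewrite raddfN /= -mulmxA mxtrace_mulC !mulmxA.
(* The shear terms cancel: t has coefficient -2 C2 from the differentiated inverse and 2 C2 from the
   second derivative of the metric. *)
move: (\tr (A *m _)) => t.
set a1 := 2 * halfline_derive phi1 0; set b1 := 2 * halfline_derive phi2 0.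
transitivity ((m%:R * a1 * (expR (- (2 * phi1 0)) * C1)
  + k%:R * b1 * (expR (- (2 * phi2 0)) * C2)) * h x a a); first by field.
by rewrite !expRN_mul !mulr1.
Qed.

End Values.
(** * The Ricci tensor at the zero section *)

Section Ricci.
Variable x : 'rV[R]_m.
Hypothesis Ux : U x.
Local Notation z0 := (row_mx x (0 : 'rV[R]_k)).
Local Notation C1 := (expR (2 * phi1 0)).
Local Notation l_ i := (lshift k i).
Local Notation r_ i := (rshift m i).
Local Notation Gf a b c := (fun y => christoffel bundle_metric y a b c).

Lemma basis_vec_lshift (l : 'I_m) : e_ (l_ l) = row_mx (e_ l) (0 : 'rV[R]_k).
Proof. by rewrite -[LHS]hsubmxK lsubmx_basisl rsubmx_basisl. Qed.

Lemma is_derive_christoffel_horizontal a b c l (F : 'rV[R]_m -> R) df :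
  (forall y, U y -> christoffel bundle_metric (row_mx y 0) a b c = F y) ->
  is_derive x (e_ l) F df -> is_derive z0 (e_ (l_ l)) (Gf a b c) df.
Proof.
move=> E Fd; rewrite basis_vec_lshift.
apply: (@is_derive_zero_section _ _ _ (Gf a b c)).
apply: near_eq_is_derive Fd.
by apply: filterS (open_nbhs_nbhs (conj oU Ux)) => y Uy; rewrite E.
Qed.

Lemma is_derive_christoffel_lll l i j c :
  is_derive z0 (e_ (l_ l)) (Gf (l_ i) (l_ j) (l_ c))
    ('D_(e_ l) (fun y => christoffel g y i j c) x).
Proof.
apply: (is_derive_christoffel_horizontal (F := fun y => christoffel g y i j c)).
  by move=> y Uy; exact: christoffel_lll.
by apply: derivableP; exact: christoffel_derivable Ux.
Qed.

Lemma is_derive_christoffel_llr l i j c :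
  is_derive z0 (e_ (l_ l)) (Gf (l_ i) (l_ j) (r_ c)) 0.
Proof.
apply: (is_derive_christoffel_horizontal (F := fun=> 0)).
by move=> y Uy; exact: christoffel_llr.
Qed.

Lemma is_derive_christoffel_lrl l i b c :
  is_derive z0 (e_ (l_ l)) (Gf (l_ i) (r_ b) (l_ c)) 0.
Proof.
apply: (is_derive_christoffel_horizontal (F := fun=> 0)).
by move=> y Uy; exact: christoffel_lrl.
Qed.

Lemma is_derive_christoffel_rll l i b c :
  is_derive z0 (e_ (l_ l)) (Gf (r_ b) (l_ i) (l_ c)) 0.
Proof.
apply: (is_derive_christoffel_horizontal (F := fun=> 0)).
by move=> y Uy; exact: christoffel_rll.
Qed.

Lemma is_derive_christoffel_lrr l i b c :
  is_derive z0 (e_ (l_ l)) (Gf (l_ i) (r_ b) (r_ c)) (partial (w^~ i) l x b c).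
Proof.
apply: (is_derive_christoffel_horizontal (F := fun y => w y i b c)).
  by move=> y Uy; exact: christoffel_lrr.
exact: (is_derive_mx_smooth l (wU i) Ux).
Qed.

Lemma is_derive_christoffel_rlr l i b c :
  is_derive z0 (e_ (l_ l)) (Gf (r_ b) (l_ i) (r_ c)) (partial (w^~ i) l x b c).
Proof.
apply: (is_derive_christoffel_horizontal (F := fun y => w y i b c)).
  by move=> y Uy; exact: christoffel_rlr.
exact: (is_derive_mx_smooth l (wU i) Ux).
Qed.

Lemma is_derive_christoffel_rr l a b c :
  is_derive z0 (e_ (l_ l)) (Gf (r_ a) (r_ b) c) 0.
Proof.
apply: (is_derive_christoffel_horizontal (F := fun=> 0)).
by move=> y Uy; exact: christoffel_rr.
Qed.

(** Vertical directions are covered by the explicit formula, horizontal ones by the values along the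
    zero section, one case per type of index. *)
Lemma christoffel_bundle_derivable l a b c : derivable (Gf a b c) z0 (e_ l).
Proof.
case: (split_ordP l) => l' ->; last first.
  by case: (is_derive_christoffel_vertical Ux l' a b c).
case: (split_ordP a) => a' ->; case: (split_ordP b) => b' ->; last first.
- by case: (is_derive_christoffel_rr l' a' b' c).
- case: (split_ordP c) => c' ->.
    by case: (is_derive_christoffel_rll l' b' a' c').
  by case: (is_derive_christoffel_rlr l' b' a' c').
- case: (split_ordP c) => c' ->.
    by case: (is_derive_christoffel_lrl l' a' b' c').
  by case: (is_derive_christoffel_lrr l' a' b' c').
case: (split_ordP c) => c' ->.
  by case: (is_derive_christoffel_lll l' a' b' c').
by case: (is_derive_christoffel_llr l' a' b' c').
Qed.

Lemma ricci_coord_horizontal i j :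
  ricci_coord bundle_metric z0 (l_ i) (l_ j) = ricci_coord g x i j
    - k%:R * (C1 * expR (- (2 * phi2 0)) * (2 * halfline_derive phi1 0)) * g x i j.
Proof.
pose cg := christoffel g x.
(* A contracted base index reproduces the Ricci tensor of g: the symbols with one fibre index below
   and a base index above vanish. *)
have hor (c : 'I_m) :
    'D_(e_ (l_ c)) (Gf (l_ i) (l_ j) (l_ c)) z0
    - 'D_(e_ (l_ i)) (Gf (l_ c) (l_ j) (l_ c)) z0
    + \sum_b (christoffel bundle_metric z0 (l_ c) b (l_ c)
              * christoffel bundle_metric z0 (l_ i) (l_ j) b
            - christoffel bundle_metric z0 (l_ i) b (l_ c)
              * christoffel bundle_metric z0 (l_ c) (l_ j) b) =
    'D_(e_ c) (fun y => christoffel g y i j c) x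
    - 'D_(e_ i) (fun y => christoffel g y c j c) x
    + \sum_b (cg c b c * cg i j b - cg i b c * cg c j b).
  rewrite (@derive_val _ _ _ _ _ _ _ (is_derive_christoffel_lll c i j c)).
  rewrite (@derive_val _ _ _ _ _ _ _ (is_derive_christoffel_lll i c j c)).
  congr (_ + _); rewrite big_split_ord /= [X in _ + X]big1 ?addr0 => [|b _].
    by apply: eq_bigr => b _; rewrite !christoffel_lll.
  by rewrite !christoffel_lrl // !mul0r subrr.
(* A contracted fibre index brings in the traces of w, of its derivatives and of its products. *)
have ver (e : 'I_k) :
    'D_(e_ (r_ e)) (Gf (l_ i) (l_ j) (r_ e)) z0
    - 'D_(e_ (l_ i)) (Gf (r_ e) (l_ j) (r_ e)) z0
    + \sum_b (christoffel bundle_metric z0 (r_ e) b (r_ e)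
              * christoffel bundle_metric z0 (l_ i) (l_ j) b
            - christoffel bundle_metric z0 (l_ i) b (r_ e)
              * christoffel bundle_metric z0 (r_ e) (l_ j) b) =
    'D_(e_ (r_ e)) (Gf (l_ i) (l_ j) (r_ e)) z0
    - partial (w^~ j) i x e e
    + (\sum_b w x b e e * cg i j b - (w x j *m w x i) e e).
  rewrite (@derive_val _ _ _ _ _ _ _ (is_derive_christoffel_rlr i j e e)).
  congr (_ + _); rewrite big_split_ord /=; congr (_ + _).
    apply: eq_bigr => b _.
    by rewrite christoffel_rlr // christoffel_lll // christoffel_llr // mul0r subr0.
  rewrite mxE -sumrN; apply: eq_bigr => b _.
  rewrite christoffel_rr // mul0r sub0r christoffel_lrr // christoffel_rlr //.
  by rewrite mulrC.
rewrite /ricci_coord big_split_ord /=.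
under eq_bigr do rewrite hor.
congr (_ + _).
under eq_bigr do rewrite ver.
rewrite big_split big_split /= !sumrB sum_derive_christoffel_llr // sumrN.
rewrite exchange_big /=.
under [X in _ + (X - _)]eq_bigr do rewrite -mulr_suml.
(* The terms in tr w_l and tr (w_i w_j) cancel outright; what remains in w is (1/2) (tr d_j w_i - tr
   d_i w_j), half a curvature trace. *)
rewrite -!/(mxtrace _) (mxtrace_partial_sym Ux i j) (mxtrace_mulC (w x j)).
rewrite -/cg.
move: (\tr (w x i *m w x j)) (\tr (partial (w^~ i) j x)) => s t.
move: (\sum_l _) => u.
by field.
Qed.

(** With a and b as in the theorem, the divergence term gives b (2 - k) h_cc and the trace term
    subtracts (a m + b k) h_cc. *)
Lemma ricci_coord_vertical a :
  ricci_coord bundle_metric z0 (r_ a) (r_ a) =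
  (2 * (2 * halfline_derive phi2 0) * (1 - k%:R)
   - (2 * halfline_derive phi1 0) * m%:R) * h x a a.
Proof.
(* Symbols with two lower fibre indices vanish, which leaves only b and c horizontal, and there the
   symbol with lower indices r, l and upper index l is zero. *)
have quad c : \sum_b (christoffel bundle_metric z0 c b c
      * christoffel bundle_metric z0 (r_ a) (r_ a) b
    - christoffel bundle_metric z0 (r_ a) b c
      * christoffel bundle_metric z0 c (r_ a) b) = 0.
  apply: big1 => b _; rewrite christoffel_rr // mulr0 sub0r.
  case: (split_ordP b) => b' ->; last first.
    by rewrite christoffel_rr // mul0r oppr0.
  case: (split_ordP c) => c' ->.
    by rewrite christoffel_rll // mul0r oppr0.
  by rewrite christoffel_rr // mulr0 oppr0.
rewrite /ricci_coord.
under eq_bigr do rewrite quad addr0.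
rewrite sumrB.
have trace : \sum_c 'D_(e_ (r_ a)) (Gf c (r_ a) c) z0 =
    'D_(e_ (r_ a)) (fun y => \sum_c christoffel bundle_metric y c (r_ a) c) z0.
  have H := is_derive_psum (fun c =>
    derivableP (@christoffel_bundle_derivable (r_ a) c (r_ a) c)).
  exact: (esym (@derive_val _ _ _ _ _ _ _ H)).
rewrite [X in _ - X]trace.
rewrite derive_christoffel_trace // big_split_ord /= big1 ?add0r => [|c _].
  rewrite sum_derive_christoffel_rrr //; ring.
exact: (@derive_val _ _ _ _ _ _ _ (is_derive_christoffel_rr c a a (l_ c))).
Qed.

End Ricci.
End BundleMetric.

(** * Local trivialisations *)

Section LocalTrivialisation.
Context {R : realType} {m k : nat} {M E : topologicalType}.
Variables (pi : E -> M) (A : atlas R m M) (B : trivialisations R k M E).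
Variables (g : idx A -> 'rV[R]_m -> 'M[R]_m) (h : tidx B -> M -> 'M[R]_k).
Variables (w : idx A -> tidx B -> 'rV[R]_m -> 'I_m -> 'M[R]_k).
Variables (phi1 phi2 : R -> R) (lambdaE : R).
Hypotheses (A_smooth : smooth_atlas A) (g_metric : riemannian_metric A g)
  (E_bundle : vector_bundle pi A B) (h_metric : fibre_metric A B h)
  (w_connection : linear_connection A B w)
  (w_compatible : compatible_connection A B w h)
  (phi1_smooth : smooth_halfline phi1) (phi2_smooth : smooth_halfline phi2)
  (E_einstein : einstein (total_space_atlas pi A B)
     (total_space_metric w h g phi1 phi2) lambdaE).
Variables (i : idx A) (t : tidx B).
Local Notation U := (bimg i t).
Local Notation hx := (h t \o @Defs.point _ _ _ A i).

Lemma bimg_point x : U x -> tdom t (Defs.point i x) /\ img i x.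
Proof.
have [_ _ pK _ _] := A_smooth.
by move=> [p [ip tp] <-]; rewrite pK //; split=> //; exists p.
Qed.

(** Inside the open image of the chart, U is the preimage of the open set [tdom t] under the inverse
    chart, which is continuous there. *)
Lemma bimg_open : open U.
Proof.
have [_ oA pK cA _] := A_smooth; have [_ [_ oB _ _ _]] := E_bundle.
have [_ oimg] := oA i; have [_ cpoint] := cA i.
rewrite openE => x Ux; have [tx ix] := bimg_point Ux.
have nt : \forall y \near x, tdom t (Defs.point i y).
  exact: (cpoint x ix _ (open_nbhs_nbhs (conj (oB t) tx))).
have ni : \forall y \near x, img i y by exact: (open_nbhs_nbhs (conj oimg ix)).
suff : \forall y \near x, U y by [].
move: nt ni; apply: filterS2 => y ty [q iq qy]; exists q => //; split=> //.
by move: ty; rewrite -qy pK.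
Qed.

Lemma g_smooth : smooth_on U (g i).
Proof.
have [gS _ _] := g_metric; apply: smooth_on_subset (gS i) => x Ux.
by have [] := bimg_point Ux.
Qed.

Lemma g_positive x : U x -> positive_definite (g i x).
Proof. by have [_ gP _] := g_metric; move=> /bimg_point[_]; exact: gP. Qed.

Lemma h_smooth : smooth_on U hx.
Proof. by have [hS _ _] := h_metric; exact: hS. Qed.

Lemma h_positive x : U x -> positive_definite (hx x).
Proof. by have [_ hP _] := h_metric; move=> /bimg_point[tx _]; exact: hP. Qed.

Lemma w_smooth a : smooth_on U ((w i t)^~ a).
Proof. by have [wS _] := w_connection; exact: wS. Qed.

(** Compatibility tested on sections with constant coordinates e_c, e_d, whose covariant derivatives
    are rows of w. *)
Lemma partial_fibre_metric x a : U x ->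
  partial hx a x = w i t x a *m hx x + hx x *m (w i t x a)^T.
Proof.
move=> Ux; apply/matrixP => c d.
rewrite -(partial_entry c d a h_smooth Ux).
have covE b : covariant_derivative w i t (basis_vec R a) (fun=> basis_vec R b) x =
    basis_vec R b *m w i t x a.
  rewrite /covariant_derivative derive_cst add0r /connection_form; congr (_ *m _).
  rewrite (bigD1 a) //= basis_vecE eqxx scale1r big1 ?addr0 // => a' a'a.
  by rewrite basis_vecE (negbTE a'a) scale0r.
have sc b : smooth_on U (fun=> basis_vec R b : 'rV[R]_k) by exact: smooth_on_cst.
have := w_compatible (sc c) (sc d) (basis_vec R a) Ux.
rewrite !covE; under eq_fun do rewrite bilin_basis.
move=> D; apply: (etrans D); rewrite [RHS]mxE -!bilin_basis /bilin !mulmxA.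
by rewrite trmx_mul !mulmxA.
Qed.

Lemma einstein_zero_section x a b : U x ->
  ricci_coord (bundle_metric (g i) hx (w i t) phi1 phi2) (row_mx x 0) a b =
  lambdaE * bundle_metric (g i) hx (w i t) phi1 phi2 (row_mx x 0) a b.
Proof.
move=> Ux; rewrite -bilin_basis -ricci_basis => [|l a' b' c']; last first.
  exact: (@christoffel_bundle_derivable _ _ _ _ _ _ _ _ _ bimg_open g_smooth
    h_smooth w_smooth g_positive h_positive phi1_smooth phi2_smooth
    partial_fibre_metric).
(* The two metrics agree by conversion; it remains to see that (x, 0) is in the image of the chart
   of E, as the coordinates of the zero vector over p. *)
apply: (@E_einstein (i, t)).
have [_ _ pK _ _] := A_smooth; have [_ [_ _ liftK _ _]] := E_bundle.
case: Ux => p [ip tp] <-; exists (Defs.lift t p 0).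
  by rewrite /= ((liftK t).2 p 0 tp).1.
by rewrite /= ((liftK t).2 p 0 tp).1 ((liftK t).2 p 0 tp).2.
Qed.

(** A single diagonal entry is compared and h_aa > 0 cancelled; x and the fibre index serve only as
    witnesses. *)
Lemma einstein_vertical x (a : 'I_k) : U x -> lambdaE =
  (2 * (2 * halfline_derive phi2 0) * (1 - k%:R)
   - 2 * halfline_derive phi1 0 * m%:R) * expR (- (2 * phi2 0)).
Proof.
move=> Ux; have := einstein_zero_section (rshift m a) (rshift m a) Ux.
rewrite bundle_metric_zero block_mxEdr mxE.
rewrite (ricci_coord_vertical bimg_open g_smooth h_smooth w_smooth g_positive
  h_positive phi1_smooth phi2_smooth partial_fibre_metric Ux).
have h0 : hx x a a != 0 := lt0r_neq0 (positive_definite_diag a (h_positive Ux)).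
rewrite [lambdaE * _]mulrA => /(mulIf h0) ->.
by rewrite -mulrA [_ * expR (- _)]mulrC expRN_mul mulr1.
Qed.

Lemma einstein_horizontal x j l : U x -> ricci_coord (g i) x j l =
  expR (2 * phi1 0) * (lambdaE + 2 * halfline_derive phi1 0 * k%:R
                                 * expR (- (2 * phi2 0))) * g i x j l.
Proof.
move=> Ux; have := einstein_zero_section (lshift k j) (lshift k l) Ux.
rewrite bundle_metric_zero block_mxEul mxE.
rewrite (ricci_coord_horizontal bimg_open g_smooth h_smooth w_smooth g_positive
  h_positive phi1_smooth phi2_smooth partial_fibre_metric Ux).
by move=> /eqP; rewrite subr_eq => /eqP ->; ring.
Qed.

End LocalTrivialisation.

(** * From one trivialisation to the whole manifold *)

Unset Implicit Arguments.

Theorem corollary2p1 (R : realType) (m k : nat) (k_gt0 : (0 < k)%N)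
  (M E : topologicalType) (pi : E -> M)
  (A : atlas R m M) (g : idx A -> 'rV[R]_m -> 'M[R]_m)
  (B : trivialisations R k M E) (h : tidx B -> M -> 'M[R]_k)
  (w : idx A -> tidx B -> 'rV[R]_m -> 'I_m -> 'M[R]_k)
  (phi1 phi2 : R -> R) (lambdaE : R)
  (M_manifold : smooth_manifold A) (g_metric : riemannian_metric A g)
  (E_bundle : vector_bundle pi A B) (h_metric : fibre_metric A B h)
  (w_connection : linear_connection A B w)
  (w_compatible : compatible_connection A B w h)
  (phi1_smooth : smooth_halfline phi1) (phi2_smooth : smooth_halfline phi2)
  (E_einstein : einstein (total_space_atlas pi A B)
     (total_space_metric w h g phi1 phi2) lambdaE) :
  let a := 2 * halfline_derive phi1 0 in
  let b := 2 * halfline_derive phi2 0 in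
  exists lambdaM : R,
    [/\ einstein A g lambdaM,
        lambdaM * expR (2 * phi2 0 - 2 * phi1 0)
          + a * (m%:R - k%:R) + 2 * b * (k%:R - 1) = 0,
        lambdaE = (2 * b * (1 - k%:R) - a * m%:R) * expR (- 2 * phi2 0) &
        lambdaE = lambdaM * expR (- 2 * phi1 0)
                  - a * k%:R * expR (- 2 * phi2 0)].
Proof.
move=> a b.
have [_ _ [p0 _] A_smooth] := M_manifold.
have [cover oA pK _ _] := A_smooth.
have [_ [tcover _ _ _ _]] := E_bundle.
have [gS gP _] := g_metric.
(* A point of the nonempty M and, by 0 < k, a fibre direction are at hand. *)
have vertical : lambdaE =
    (2 * b * (1 - k%:R) - a * m%:R) * expR (- (2 * phi2 0)).
  have [i ip] := cover p0; have [t tp] := tcover p0.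
  have Ux : bimg i t (Defs.coord i p0) by exists p0.
  exact: (einstein_vertical A_smooth g_metric E_bundle h_metric w_connection
    w_compatible phi1_smooth phi2_smooth E_einstein (Ordinal k_gt0) Ux).
(* The factor of g in [einstein_horizontal], which involves neither the chart nor the point. *)
pose lambdaM := expR (2 * phi1 0) * (lambdaE + a * k%:R * expR (- (2 * phi2 0))).
exists lambdaM; rewrite !mulNr; split => //.
- move=> i; apply: (einstein_on_coord (oA i).2 (gS i) (gP i)) => x ix j l.
  have [p ip px] := ix; have [t tp] := tcover p.
  have Ux : bimg i t x by exists p.
  exact: (einstein_horizontal A_smooth g_metric E_bundle h_metric w_connection
    w_compatible phi1_smooth phi2_smooth E_einstein j l Ux).
(* Inserting the vertical value of lambdaE turns lambdaM e^(2 phi2 - 2 phi1) into 2 b (1 - k) - a m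
   + a k. *)
- rewrite /lambdaM vertical expRD.
  transitivity ((expR (- (2 * phi1 0)) * expR (2 * phi1 0)) *
    ((2 * b * (1 - k%:R) - a * m%:R + a * k%:R)
      * (expR (- (2 * phi2 0)) * expR (2 * phi2 0)))
    + a * (m%:R - k%:R) + 2 * b * (k%:R - 1)); first by ring.
  by rewrite !expRN_mul; ring.
- transitivity (expR (- (2 * phi1 0)) * expR (2 * phi1 0) *
    (lambdaE + a * k%:R * expR (- (2 * phi2 0))) - a * k%:R * expR (- (2 * phi2 0))).
    by rewrite expRN_mul; ring.
  by rewrite /lambdaM; ring.
Qed.
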